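(* Let $\beta$ be a positive root and let $\beta=s_{i_r}\cdots s_{i_2}s_{i_1}\alpha_j$ be a positive expression for $\beta$. The shard modules of dimension $\beta$ are precisely (up to isomorphism) those modules $\Sigma^{\pm_r}_{i_r}\cdots\Sigma^{\pm_2}_{i_2}\Sigma^{\pm_1}_{i_1}S_j$ which are well defined and for which $\sigma_{i_r}^{\pm_r}\cdots\sigma_{i_2}^{\pm_2}\sigma_{i_1}^{\pm_1}(\alpha_j^{\perp})$ has dimension $n-1$.
   Context: Root system. Let $d_1,\dots,d_n$ be positive integers and let $A=(A_{ij})$ be an $n\times n$ integer matrix with $A_{ii}=2$, $d_iA_{ij}=d_jA_{ji}$, and $A_{ij}\le 0$ for $i\ne j$ (a crystallographic symmetrizable Cartan matrix). Let $V$ be the real vector space with basis $\alpha_1,\dots,\alpha_n$, with symmetric bilinear form $(\alpha_i,\alpha_j)=d_iA_{ij}$; put $\alpha_i^\vee=d_i^{-1}\alpha_i$ and $s_i(x)=x-(\alpha_i^\vee,x)\alpha_i$. Let $W\subset \mathrm{GL}(V)$ be generated by the $s_i$. The set of (real) roots is $\Phi=\{w\alpha_i: w\in W,\ 1\le i\le n\}$; every root is a nonnegative (positive root, $\Phi^+$) or nonpositive (negative root) combination of the $\alpha_i$. Let $V^*$ be the dual space with pairing $\langle\ ,\ \rangle$, with $W$ acting by $\langle w\eta,w\beta\rangle=\langle\eta,\beta\rangle$, and for $\beta\in V$ put $\beta^\perp=\{\theta\in V^*:\langle\theta,\beta\rangle=0\}$. Positive expressions. A positive expression for a positive root $\beta$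 is a formula $\beta=s_{i_r}\cdots s_{i_1}\alpha_j$ ($r\ge 0$) such that for all $1\le k\le r$, $s_{i_k}s_{i_{k-1}}\cdots s_{i_1}\alpha_j-s_{i_{k-1}}\cdots s_{i_1}\alpha_j\in\mathbb R_{>0}\alpha_{i_k}$. Cone operations. For a convex polyhedral cone $K\subseteq V^*$: $\sigma_i^+(K)=s_i(K\cap\{x:\langle x,\alpha_i\rangle\ge0\})$ and $\sigma_i^-(K)=s_i(K\cap\{x:\langle x,\alpha_i\rangle\le0\})$. Preprojective algebra. Put $d_{ij}=\mathrm{LCM}(d_i,d_j)$, $L=\mathrm{LCM}(d_1,\dots,d_n)$. Let $\kappa(L)/\kappa$ be a Galois extension of fields with cyclic Galois group of order $L$, and for $d\mid L$ let $\kappa(d)$ be the unique subextension of degree $d$ over $\kappa$. Let $\Gamma$ be the quiver with vertices $1,\dots,n$ and, for $i\neq j$, $-d_iA_{ij}/d_{ij}$ arrows $i\to j$; fix a bijection $a\mapsto a^*$ between arrows $i\to j$ and arrows $j\to i$ with $(a^* )^*=a$. Let $E(j\leftarrow i)$ be the $\kappa(d_{ij})$-vector space with basis the arrows $i\to j$, regarded as a $\kappa(d_j)$-$\kappa(d_i)$-bimodule. The path algebra is the tensor algebra over $\prod_i\kappa(d_i)$ of the bimodule $\bigoplus_{i\ne j}E(j\leftarrow i)$. For $i\ne j$ let $(b^{ji}_k)_k$ be a $\kappa(d_j)$-basis of $\kappa(d_{ij})$ and $((b^{ji}_k)^* )_k$ the dual basis for the trace pairing $(b,b')\mapsto\mathrm{tr}_{\kappa(d_{ij})/\kappa(d_j)}(bb')$.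 Fix signs $\mathrm{sgn}(i,j)\in\{\pm1\}$ for $i\ne j$ with $\mathrm{sgn}(i,j)=-\mathrm{sgn}(j,i)$. The preprojective algebra $\Lambda$ is the quotient of the path algebra by the relations $\sum_{j\ne i}\mathrm{sgn}(i,j)\sum_{a:i\to j}\sum_k (b^{ji}_k)^*a^*\otimes a\,b^{ji}_k=0$ for $1\le i\le n$ (up to isomorphism independent of the choices). A $\Lambda$-module $M$ (left module) is a collection of $\kappa(d_i)$-vector spaces $M_i$ with $\kappa(d_j)$-linear maps $M_{j\leftarrow i}:E(j\leftarrow i)\otimes_{\kappa(d_i)}M_i\to M_j$ satisfying these relations; $M$ is finite dimensional if all $M_i$ are finite dimensional over $\kappa$, and then its dimension is $\dim M=\sum_i(\dim_{\kappa(d_i)}M_i)\alpha_i\in V$. $S_i$ is the module with $\kappa(d_i)$ at vertex $i$ and $0$ elsewhere. Shard modules. $M$ is $\theta$-semistable, for $\theta\in V^*$, if $\langle\theta,\dim M\rangle=0$ and $\langle\theta,\dim K\rangle\ge0$ for every submodule $K\subseteq M$; $\mathrm{Stab}(M)$ is the closed polyhedral cone of $\theta\in V^*$ for which $M$ is $\theta$-semistable. A brick is a nonzero finite dimensional $\Lambda$-module whose endomorphism ring is a division ring; a real brick is a brick whose dimension vector is a real root; a shard module is a real brick $B$ with $\mathrm{Stab}(B)$ of dimension $n-1$. Reflection functors. $\mathrm{NoSub}_i$ (resp. $\mathrm{NoQuot}_i$) is the full subcategory of finite dimensional $\Lambda$-modules not having $S_i$ as a submodule (resp. quotient). Put $M_{\partial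 i}=\bigoplus_{j\ne i}E(i\leftarrow j)\otimes_{\kappa(d_j)}M_j$; let $M_{i,\mathrm{in}}:M_{\partial i}\to M_i$ be $\mathrm{sgn}(i,j)M_{i\leftarrow j}$ on the $j$th summand, and $M_{i,\mathrm{out}}:M_i\to M_{\partial i}$ have $j$th component $m\mapsto\sum_{a:i\to j}\sum_k(b^{ji}_k)^*a^*\otimes M_{j\leftarrow i}(a\,b^{ji}_k\otimes m)$. The preprojective relations say $M_{i,\mathrm{in}}M_{i,\mathrm{out}}=0$; $M\in\mathrm{NoSub}_i$ iff $M_{i,\mathrm{out}}$ is injective, $M\in\mathrm{NoQuot}_i$ iff $M_{i,\mathrm{in}}$ is surjective. For $M\in\mathrm{NoQuot}_i$, $\Sigma_i(M)=\Sigma_i^+(M)$ is obtained from $M$ by replacing $M_i$ by $\mathrm{Ker}(M_{i,\mathrm{in}})$, with out-map the inclusion $\mathrm{Ker}(M_{i,\mathrm{in}})\hookrightarrow M_{\partial i}$ and in-map $M_{i,\mathrm{out}}M_{i,\mathrm{in}}:M_{\partial i}\to\mathrm{Ker}(M_{i,\mathrm{in}})$, all other data unchanged. For $M\in\mathrm{NoSub}_i$, $\Sigma_i^{-1}(M)=\Sigma_i^-(M)$ is obtained by replacing $M_i$ by $\mathrm{CoKer}(M_{i,\mathrm{out}})$, with in-map the quotient map from $M_{\partial i}$ and out-map $\mathrm{CoKer}(M_{i,\mathrm{out}})\to M_{\partial i}$ induced by $M_{i,\mathrm{out}}M_{i,\mathrm{in}}$, all other data unchanged. These are mutually inverse equivalences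 between $\mathrm{NoQuot}_i$ and $\mathrm{NoSub}_i$; $\Sigma_i$ is only defined on $\mathrm{NoQuot}_i$ and $\Sigma_i^{-1}$ only on $\mathrm{NoSub}_i$. The expression $\Sigma^{\pm_r}_{i_r}\cdots\Sigma^{\pm_1}_{i_1}S_j$ is well defined if for each $q$ the partial product $\Sigma^{\pm_{q-1}}_{i_{q-1}}\cdots\Sigma^{\pm_1}_{i_1}S_j$ lies in $\mathrm{NoQuot}_{i_q}$ when $\pm_q=+$, and in $\mathrm{NoSub}_{i_q}$ when $\pm_q=-$. *)

(* Defs.v *)
From HB Require Import structures.
From mathcomp Require Import all_boot all_order all_algebra.
From mathcomp Require Import all_fingroup all_solvable all_field.
From mathcomp Require Import classical_sets reals.

Set Implicit Arguments.
Unset Strict Implicit.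
Unset Printing Implicit Defensive.

Import Order.TTheory GRing.Theory Num.Theory.
Local Open Scope classical_set_scope.
Local Open Scope ring_scope.

(* For subfields [E], [F] contained in [D], the direct sum [D^N] is an        *)
(* [E]-[F]-bimodule.  [tens E F D N V] is the tensor product of [D^N] with an *)
(* [F]-space [V], in coordinates relative to [vbasis {:V}]; it is an          *)
(* [E]-space because [vspaceOver E D] is [D] as an [E]-space.  [pure a x v]   *)
(* is the tensor of [v] with [x] times the [a]-th basis vector of [D^N]; it   *)
(* is only meaningful for [x \in D].  See [tens_universal].                   *)
Section Tensor.
Variables (kappa : fieldType) (K : fieldExtType kappa) (E F D : {subfield K}).
Variable N : nat.

Definition tens (V : vectType (subvs_of F)) : vectType (subvs_of E) :=
  {ffun 'I_N * 'I_(\dim {:V}) -> subvs_of (vspaceOver E D)}.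

Definition pure (V : vectType (subvs_of F)) (a : 'I_N) (x : K) (v : V) : tens V :=
  [ffun p => if p.1 == a
             then vsproj (vspaceOver E D)
                         (x * vsval (coord (vbasis {:V}) p.2 v))
             else 0].

(* [id (x) f], see [tens_map_pure]. *)
Definition tens_map (V W : vectType (subvs_of F)) (f : 'Hom(V, W)) (t : tens V)
    : tens W :=
  \sum_(p : 'I_N * 'I_(\dim {:V}))
     pure p.1 (vsval (t p)) (f (vbasis {:V})`_p.2).

Hypotheses (sED : (E <= D)%VS) (sFD : (F <= D)%VS).

Lemma val_pure (V : vectType (subvs_of F)) a x (v : V) p :
  x \in D -> vsval (pure a x v p) =
  if p.1 == a then x * vsval (coord (vbasis {:V}) p.2 v) else 0.
Proof.
move=> Dx; rewrite ffunE; case: ifP => // _; rewrite vsprojK //.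
by rewrite mem_aspaceOver //; apply: memvM => //; apply/(subvP sFD)/subvsP.
Qed.

Lemma tens_val_in (V : vectType (subvs_of F)) (t : tens V) p : vsval (t p) \in D.
Proof. by rewrite -(mem_aspaceOver sED) subvsP. Qed.

Lemma pureDl (V : vectType (subvs_of F)) a x y (v : V) :
  x \in D -> y \in D -> pure a (x + y) v = pure a x v + pure a y v.
Proof.
move=> Dx Dy; apply/ffunP => p; rewrite [RHS]ffunE; apply/val_inj.
rewrite /= !val_pure ?rpredD //; case: ifP; rewrite ?mulrDl ?addr0 //.
Qed.

Lemma pureDr (V : vectType (subvs_of F)) a x (v w : V) :
  x \in D -> pure a x (v + w) = pure a x v + pure a x w.
Proof.
move=> Dx; apply/ffunP => p; rewrite [RHS]ffunE; apply/val_inj.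
by rewrite /= !val_pure // linearD /=; case: ifP; rewrite ?mulrDr ?addr0.
Qed.

Lemma pure_bal (V : vectType (subvs_of F)) a x (c : subvs_of F) (v : V) :
  x \in D -> pure a (x * vsval c) v = pure a x (c *: v).
Proof.
move=> Dx; apply/ffunP => p; apply/val_inj.
rewrite /= !val_pure //; last by rewrite memvM // (subvP sFD) // subvsP.
by rewrite linearZ /= -mulrA.
Qed.

Lemma pureZ (V : vectType (subvs_of F)) a x (c : subvs_of E) (v : V) :
  x \in D -> pure a (vsval c * x) v = c *: pure a x v.
Proof.
move=> Dx; apply/ffunP => p; rewrite [RHS]ffunE; apply/val_inj.
have Dc: vsval c \in D by rewrite (subvP sED) // subvsP.
rewrite [LHS]val_pure; last exact: memvM.
rewrite linearZ /= val_pure // fieldOver_scaleE.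
by case: ifP; rewrite ?mulr0 ?mulrA.
Qed.

Lemma pure_sum (V : vectType (subvs_of F)) (t : tens V) :
  t = \sum_(p : 'I_N * 'I_(\dim {:V}))
        pure p.1 (vsval (t p)) (vbasis {:V})`_p.2.
Proof.
apply/ffunP => q; rewrite sum_ffunE; apply/val_inj; rewrite /= linear_sum /=.
rewrite (bigD1 q) //= val_pure ?tens_val_in // eqxx.
rewrite big1 => [|p npq].
  rewrite addr0 coord_free ?(basis_free (vbasisP _)) // eqxx.
  by rewrite /= algid1 mulr1.
rewrite val_pure ?tens_val_in //; case: eqP => // q1.
rewrite coord_free ?(basis_free (vbasisP _)) //; case: eqP => [q2|_].
  by case/eqP: npq; case: p q q1 q2 => [? ?] [? ?] /= -> ->.
by rewrite mulr0.
Qed.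

Lemma tens_universal (V : vectType (subvs_of F)) (U : vectType (subvs_of E))
    (g : 'I_N -> K -> V -> U) :
  (forall a x y v, x \in D -> y \in D -> g a (x + y) v = g a x v + g a y v) ->
  (forall a x v w, x \in D -> g a x (v + w) = g a x v + g a x w) ->
  (forall a x c v, x \in D -> g a (x * vsval c) v = g a x (c *: v)) ->
  (forall a x c v, x \in D -> g a (vsval c * x) v = c *: g a x v) ->
  exists! h : 'Hom(tens V, U),
    forall a x v, x \in D -> h (pure a x v) = g a x v.
Proof.
move=> gDl gDr gbal gZ.
pose h0 (t : tens V) : U :=
  \sum_(p : 'I_N * 'I_(\dim {:V})) g p.1 (vsval (t p)) (vbasis {:V})`_p.2.
have h0_lin : linear h0.
  move=> c t u; rewrite /h0 scaler_sumr -big_split /=; apply: eq_bigr => p _.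
  by rewrite !ffunE linearP /= gDl ?gZ ?tens_val_in //;
     apply: memvM; rewrite ?tens_val_in ?(subvP sED) ?subvsP.
pose h0M := GRing.isLinear.Build _ _ _ _ h0 h0_lin.
pose h0L : {linear tens V -> U} := HB.pack h0 h0M.
have g0 a v : g a 0 v = 0.
  by apply: (addrI (g a 0 v)); rewrite -gDl ?mem0v // !addr0.
have gr0 a x : x \in D -> g a x 0 = 0.
  by move=> Dx; apply: (addrI (g a x 0)); rewrite -gDr // !addr0.
have h0_pure a x v : x \in D -> h0 (pure a x v) = g a x v.
  move=> Dx; rewrite /h0 [in RHS](coord_vbasis (memvf v)).
  rewrite (big_morph _ (fun y z => gDr a x y z Dx) (gr0 a x Dx)).
  rewrite (eq_bigr (fun p => if p.1 == a then
     g a x (coord (vbasis {:V}) p.2 v *: (vbasis {:V})`_p.2) else 0)); last first.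
    case=> b l _ /=; rewrite val_pure //=.
    by case: eqP => [->|_] //; rewrite -gbal.
  rewrite -(pair_bigA _ (fun b l => if b == a then
     g a x (coord (vbasis {:V}) l v *: (vbasis {:V})`_l) else 0)) /=.
  rewrite (bigD1 a) //= eqxx [X in _ + X]big1 ?addr0 // => b /negPf ->.
  by rewrite big1.
exists (linfun h0L); split=> [a x v Dx|h hE]; first by rewrite lfunE /= h0_pure.
apply/lfunP => t; rewrite lfunE /= /h0 [in RHS](pure_sum t) linear_sum.
by apply: eq_bigr => p _; apply/esym/hE; apply: tens_val_in.
Qed.


Lemma tens_map_pure (V W : vectType (subvs_of F)) (f : 'Hom(V, W)) a x v :
  x \in D -> tens_map f (pure a x v) = pure a x (f v).
Proof.
move=> Dx; pose g b y w : tens W := @pure W b y (f w).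
have [||||h [hE _]] := @tens_universal V (tens W) g.
- by move=> *; apply: pureDl.
- by move=> *; rewrite /g linearD; apply: pureDr.
- by move=> *; rewrite /g linearZ; apply: pure_bal.
- by move=> *; apply: pureZ.
rewrite -[RHS](hE a x v Dx) {2}(pure_sum (pure a x v)) linear_sum.
by apply: eq_bigr => p _; apply/esym/hE; apply: tens_val_in.
Qed.

End Tensor.

Record cartan_datum (n : nat) := CartanDatum {
  dsym : 'I_n -> nat;
  cartan : 'M[int]_n;
  dsym_gt0 : forall i, (0 < dsym i)%N;
  cartan_diag : forall i, cartan i i = 2;
  cartan_sym : forall i j,
    (dsym i)%:Z * cartan i j = (dsym j)%:Z * cartan j i;
  cartan_offdiag : forall i j, i != j -> cartan i j <= 0
}.

Section RootSystem.
Variables (R : realType) (n : nat) (C : cartan_datum n).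

Local Notation V := 'rV[R]_n.
Local Notation Vdual := 'Hom('rV[R]_n, R^o).

Definition alpha (i : 'I_n) : V := delta_mx 0 i.

Definition form (x y : V) : R :=
  \sum_i \sum_j x 0 i * y 0 j * ((dsym C i)%:Z * cartan C i j)%:~R.

Definition coroot (i : 'I_n) : V := (dsym C i)%:R^-1 *: alpha i.

Definition refl (i : 'I_n) (x : V) : V := x - form (coroot i) x *: alpha i.

(* The subgroup of [GL(V)] generated by the simple reflections. *)
Inductive weyl : (V -> V) -> Prop :=
| weyl1 : weyl id
| weyl_refl i : weyl (refl i)
| weylM w1 w2 : weyl w1 -> weyl w2 -> weyl (w1 \o w2)
| weylV w w' : weyl w -> cancel w w' -> cancel w' w -> weyl w'.

Definition is_root (b : V) : Prop := exists w i, weyl w /\ b = w (alpha i).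

Definition is_positive_root (b : V) : Prop :=
  is_root b /\ forall i, 0 <= b 0 i.

(* [apply_word [:: i_1; ..; i_r] v] is [s_{i_r} .. s_{i_1} v]. *)
Definition apply_word (s : seq 'I_n) (v : V) : V :=
  foldl (fun x i => refl i x) v s.

Definition positive_expression (s : seq 'I_n) (j : 'I_n) (b : V) : Prop :=
  b = apply_word s (alpha j) /\
  forall s1 i s2, s = s1 ++ i :: s2 ->
    exists2 c : R, 0 < c &
      apply_word (rcons s1 i) (alpha j) - apply_word s1 (alpha j) = c *: alpha i.

Lemma form_is_linear x : linear (form x : V -> R^o).
Proof.
move=> c y z; rewrite /form scaler_sumr -big_split /=.
apply: eq_bigr => k _; rewrite scaler_sumr -big_split /=.
apply: eq_bigr => l _; rewrite !mxE mulrDr mulrDl mulrCA.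
by rewrite -[(c * _) * _]mulrA.
Qed.

HB.instance Definition _ x :=
  GRing.isLinear.Build R V R^o *:%R (form x : V -> R^o) (form_is_linear x).

Lemma refl_is_linear i : linear (refl i).
Proof.
move=> c x y; rewrite /refl form_is_linear scalerDl scalerBr -scalerA opprD.
exact: addrACA.
Qed.

HB.instance Definition _ i :=
  GRing.isLinear.Build R V V *:%R (refl i) (refl_is_linear i).

Lemma form_coroot_alpha i : form (coroot i) (alpha i) = 2.
Proof.
rewrite /form (bigD1 i) //= [X in _ + X]big1 ?addr0 => [|k nki]; last first.
  by apply: big1 => j _; rewrite !mxE (negPf nki) andbF mulr0 !mul0r.
rewrite (bigD1 i) //= [X in _ + X]big1 ?addr0 => [|k nki]; last first.
  by rewrite !mxE (negPf nki) andbF mulr0 mul0r.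
rewrite !mxE !eqxx !mulr1 cartan_diag intrM mulrA mulVf ?mul1r //.
by rewrite pnatr_eq0 -lt0n dsym_gt0.
Qed.

Lemma reflK i : involutive (refl i).
Proof.
move=> x; rewrite {1}/refl {1}/refl -!scaleNr.
rewrite [form _ (refl i x)](_ : _ = - form (coroot i) x).
  by rewrite opprK scaleNr subrK.
rewrite /refl addrC -scaleNr form_is_linear form_coroot_alpha.
by rewrite /GRing.scale /= mulNr mulr_natr mulr2n opprD addrNK.
Qed.

(* The action on the dual space; since [refl i] is an involution it is        *)
(* contragredient to the action on [V], see [dual_reflE].                     *)
Definition dual_refl (i : 'I_n) (theta : Vdual) : Vdual :=
  (theta \o linfun (refl i))%VF.

Lemma dual_reflE i (theta : Vdual) x : dual_refl i theta (refl i x) = theta x.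
Proof. by rewrite /dual_refl comp_lfunE lfunE /= reflK. Qed.

Definition perp (b : V) : set Vdual := [set theta | theta b = 0].

(* [true] stands for the sign [+] and [false] for [-]. *)
Definition sigma_cone (e : bool) (i : 'I_n) (X : set Vdual) : set Vdual :=
  dual_refl i @`
    (X `&` [set theta | if e then 0 <= theta (alpha i) else theta (alpha i) <= 0]).

(* [sigma_cone_word [:: (i_1, e_1); ..; (i_r, e_r)]] applies the operation    *)
(* with index [i_1] first.                                                    *)
Definition sigma_cone_word (s : seq ('I_n * bool)) (X : set Vdual) : set Vdual :=
  foldl (fun Y p => sigma_cone p.2 p.1 Y) X s.

(* The dimension of a cone (containing 0) is that of its linear span. *)
Definition cone_has_dim (X : set Vdual) (m : nat) : Prop :=
  exists U : {vspace Vdual},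
    [/\ forall theta, X theta -> theta \in U,
        forall U' : {vspace Vdual},
          (forall theta, X theta -> theta \in U') -> (U <= U')%VS
      & \dim U = m].

End RootSystem.

Section Combinatorics.
Variables (n : nat) (C : cartan_datum n).

Definition dlcm (i j : 'I_n) : nat := lcmn (dsym C i) (dsym C j).

Definition total_lcm : nat := \big[lcmn/1%N]_(i < n) dsym C i.

Definition narrows (i j : 'I_n) : nat :=
  if i == j then 0%N else (absz ((dsym C i)%:Z * cartan C i j)%R %/ dlcm i j)%N.

End Combinatorics.

(* The choices entering the definition of the preprojective algebra.         *)
(* [subfld m] is only constrained when [m] divides the lcm of the [d_i], and  *)
(* is then the unique subextension of degree [m] (when [K] is cyclic Galois   *)
(* of that lcm as degree over [kappa]).  The trace of [kappa(d_ij)] over      *)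
(* [kappa(d_j)] is [galTrace].  [sgn i j] is the exponent of the sign.        *)
Record preproj_datum (n : nat) (C : cartan_datum n)
    (kappa : fieldType) (K : splittingFieldType kappa) := PreprojDatum {
  subfld : nat -> {subfield K};
  subfld_dim : forall m, (m %| total_lcm C)%N -> \dim (subfld m) = m;
  star : forall i j, 'I_(narrows C i j) -> 'I_(narrows C j i);
  starK : forall i j (a : 'I_(narrows C i j)), star (star a) = a;
  bas : 'I_n -> 'I_n -> seq K;
  basP : forall i j, i != j ->
    basis_of (vspaceOver (subfld (dsym C j)) (subfld (dlcm C i j)))
             (bas j i : seq (fieldOver (subfld (dsym C j))));
  dual_bas : 'I_n -> 'I_n -> seq K;
  size_dual_bas : forall i j, i != j -> size (dual_bas j i) = size (bas j i);
  dual_bas_mem : forall i j, i != j ->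
    {subset dual_bas j i <= subfld (dlcm C i j)};
  dual_basP : forall i j, i != j -> forall k l,
    (k < size (bas j i))%N -> (l < size (bas j i))%N ->
    galTrace (subfld (dsym C j)) (subfld (dlcm C i j))
             ((bas j i)`_k * (dual_bas j i)`_l) = (k == l)%:R;
  sgn : 'I_n -> 'I_n -> bool;
  sgn_anti : forall i j, i != j -> sgn i j = ~~ sgn j i
}.

Section Modules.
Variables (n : nat) (C : cartan_datum n).
Variables (kappa : fieldType) (K : splittingFieldType kappa).
Variable D : preproj_datum C K.

Local Notation kap i := (subfld D (dsym C i)).
Local Notation kap2 i j := (subfld D (dlcm C i j)).

(* [edge j i U] is the tensor product of [E(j <- i)] with [U] over            *)
(* [kappa(d_i)]; it is zero for [i = j], as [narrows C i i = 0].              *)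
Definition edge (j i : 'I_n) (U : vectType (subvs_of (kap i))) :
    vectType (subvs_of (kap j)) :=
  tens (kap j) (kap2 i j) (narrows C i j) U.

(* The tensor of the element [x a] of [E(j <- i)] with [m]. *)
Definition epure (j i : 'I_n) (U : vectType (subvs_of (kap i)))
    (a : 'I_(narrows C i j)) (x : K) (m : U) : edge j U :=
  pure (kap j) (kap2 i j) a x m.

Definition edge_map (j i : 'I_n) (U U' : vectType (subvs_of (kap i)))
    (f : 'Hom(U, U')) (t : edge j U) : edge j U' :=
  tens_map f t.

(* Finite dimensional modules over the path algebra. *)
Record path_module := PathModule {
  msp :> forall i, vectType (subvs_of (kap i));
  mact : forall j i, 'Hom(edge j (msp i), msp j)
}.

Definition preproj_relations (M : path_module) : Prop :=
  forall (i : 'I_n) (m : M i),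
    \sum_(j | j != i) (-1) ^+ sgn D i j *:
      \sum_(a < narrows C i j) \sum_(k < size (bas D j i))
        mact M i j (epure (star D a) (dual_bas D j i)`_k
          (mact M j i (epure a (bas D j i)`_k m))) = 0.

(* Finite dimensional modules over the preprojective algebra. *)
Record module := Module {
  mpath :> path_module;
  mrel : preproj_relations mpath
}.

Record hom (M N : module) := Hom {
  hmap :> forall i, 'Hom(M i, N i);
  homP : forall j i (a : 'I_(narrows C i j)) (x : K) (m : M i),
    x \in kap2 i j ->
    hmap j (mact M j i (epure a x m)) = mact N j i (epure a x (hmap i m))
}.

Definition isomorphic (M N : module) : Prop :=
  exists (f : hom M N) (g : hom N M),
    forall i, cancel (f i) (g i) /\ cancel (g i) (f i).

Definition is_submodule (M : module) (U : forall i, {vspace M i}) : Prop :=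
  forall j i (a : 'I_(narrows C i j)) (x : K) (m : M i),
    x \in kap2 i j -> m \in U i -> mact M j i (epure a x m) \in U j.

Definition simple_path_module (i : 'I_n) : path_module :=
  @PathModule (fun k => 'rV[subvs_of (kap k)]_(k == i)) (fun _ _ => 0).

Lemma simple_relations i : preproj_relations (simple_path_module i).
Proof.
move=> k m; apply: big1 => j _; rewrite big1 ?scaler0 // => a _.
by apply: big1 => l _; rewrite lfunE.
Qed.

Definition simple_module (i : 'I_n) : module := Module (@simple_relations i).

Definition no_sub (i : 'I_n) (M : module) : Prop :=
  ~ exists f : hom (simple_module i) M, forall k, injective (f k).

Definition no_quot (i : 'I_n) (M : module) : Prop :=
  ~ exists f : hom M (simple_module i),
      forall k (y : simple_module i k), exists x, f k x = y.

(* An element of [M_{partial i}] is a family; the entry at [j = i] lies in a  *)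
(* zero space.                                                                *)
Definition around (i : 'I_n) (M : module) : Type := forall j, edge i (M j).

Definition in_map (i : 'I_n) (M : module) (t : around i M) : M i :=
  \sum_(j | j != i) (-1) ^+ sgn D i j *: mact M i j (t j).

Definition out_map (i : 'I_n) (M : module) (m : M i) : around i M := fun j =>
  \sum_(a < narrows C i j) \sum_(k < size (bas D j i))
    epure (star D a) (dual_bas D j i)`_k (mact M j i (epure a (bas D j i)`_k m)).

Definition around_map (i : 'I_n) (M N : module)
    (phi : forall k, 'Hom(M k, N k)) (t : around i M) : around i N :=
  fun j => edge_map (phi j) (t j).

(* [phi] identifies [M] and [N] away from the vertex [i], compatibly with the *)
(* structure maps between the vertices other than [i]; [phi i] plays no role. *)
Definition iso_off (i : 'I_n) (M N : module)
    (phi : forall k, 'Hom(M k, N k)) : Prop :=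
  (forall k, k != i -> bijective (phi k)) /\
  (forall j k, j != i -> k != i ->
   forall (a : 'I_(narrows C k j)) (x : K) (m : M k), x \in kap2 k j ->
     phi j (mact M j k (epure a x m)) = mact N j k (epure a x (phi k m))).

(* [is_Sigma_plus i M N]: [N] is isomorphic to the module obtained from [M]   *)
(* by replacing [M i] with the kernel of [in_map i M]; [iota] is the induced  *)
(* inclusion of [N i] in [M_{partial i}].                                     *)
Definition is_Sigma_plus (i : 'I_n) (M N : module) : Prop :=
  exists (phi : forall k, 'Hom(N k, M k))
         (iota : forall j, 'Hom(N i, edge i (M j))),
    [/\ iso_off i phi,
        forall m, (forall j, iota j m = 0) -> m = 0,
        forall t : around i M,
          in_map t = 0 <-> exists m, forall j, iota j m = t j,
        forall (m : N i) j, around_map phi (out_map m) j = iota j m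
      & forall (t : around i N) j,
          iota j (in_map t) = out_map (in_map (around_map phi t)) j].

(* [is_Sigma_minus i M N]: [N] is isomorphic to the module obtained from [M]  *)
(* by replacing [M i] with the cokernel of [out_map i M]; the [j]-th          *)
(* component of the induced surjection from [M_{partial i}] to [N i] is       *)
(* [pi j].                                                                    *)
Definition is_Sigma_minus (i : 'I_n) (M N : module) : Prop :=
  exists (phi : forall k, 'Hom(N k, M k))
         (pi : forall j, 'Hom(edge i (M j), N i)),
    let proj (t : around i M) : N i := \sum_(j | j != i) pi j (t j) in
    [/\ iso_off i phi,
        forall m, exists t, proj t = m,
        forall t : around i M,
          proj t = 0 <-> exists m, forall j, t j = out_map m j,
        forall t : around i N, in_map t = proj (around_map phi t)
      & forall (t : around i M) j,
          around_map phi (out_map (proj t)) j = out_map (in_map t) j].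

(* One well-defined step of the word of reflection functors; [true] stands    *)
(* for [Sigma_i] and [false] for its inverse.                                 *)
Definition Sigma_step (e : bool) (i : 'I_n) (M N : module) : Prop :=
  if e then no_quot i M /\ is_Sigma_plus i M N
  else no_sub i M /\ is_Sigma_minus i M N.

(* [is_Sigma_word [:: (i_1, e_1); ..; (i_r, e_r)] M N]: the composite applied *)
(* to [M], with index [i_1] first, is well defined and isomorphic to [N].     *)
Fixpoint is_Sigma_word (s : seq ('I_n * bool)) (M N : module) : Prop :=
  if s is (i, e) :: s' then
    exists2 M' : module, Sigma_step e i M M' & is_Sigma_word s' M' N
  else isomorphic M N.

Section Shards.
Variable R : realType.

Definition dimvec (M : forall i, vectType (subvs_of (kap i)))
    (U : forall i, {vspace M i}) : 'rV[R]_n := \row_i (\dim (U i))%:R.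

Definition mdim (M : module) : 'rV[R]_n := dimvec (fun i => fullv : {vspace M i}).

Definition semistable (theta : 'Hom('rV[R]_n, R^o)) (M : module) : Prop :=
  theta (mdim M) = 0 /\
  forall U : forall i, {vspace M i}, is_submodule U -> 0 <= theta (dimvec U).

Definition Stab (M : module) : set 'Hom('rV[R]_n, R^o) :=
  [set theta | semistable theta M].

(* A nonzero module each of whose nonzero endomorphisms is invertible. *)
Definition brick (M : module) : Prop :=
  (exists i (m : M i), m != 0) /\
  forall f : hom M M, (exists i, f i != 0) ->
    exists g : hom M M, forall i, cancel (f i) (g i) /\ cancel (g i) (f i).

Definition real_brick (M : module) : Prop := brick M /\ is_root C (mdim M).

Definition shard_module (M : module) : Prop :=
  real_brick M /\ cone_has_dim (Stab M) n.-1.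

End Shards.
End Modules.

(* Main.v *)
From HB Require Import structures.
Require Import Defs.
From mathcomp Require Import all_boot all_order all_algebra.
From mathcomp Require Import all_fingroup all_solvable all_field.
From mathcomp Require Import boolp classical_sets reals.

Set Implicit Arguments.
Unset Strict Implicit.
Unset Printing Implicit Defensive.

Import Order.TTheory GRing.Theory Num.Theory VectorInternalTheory.
Local Open Scope ring_scope.

(** The functor Sigma_i relates two modules M and N which agree away from the
    vertex i and for which the out-map of N and the in-map of M form a short
    exact sequence

        0 -> N_i -> M_(around i) -> M_i -> 0,

    where moreover the composite of the in-map and the out-map is the same for
    both.  This is the relation [refl_pair]; Sigma_i M = N and
    Sigma_i^-1 N = M both amount to it ([Sigma_plusP], [Sigma_minusP]), so
    that every statement about the two functors need only be proved once.
    Three facts are read off from the sequence: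

    - dim N = s_i (dim M), by counting dimensions ([rp_mdim]);
    - M is a brick if and only if N is, since endomorphisms of one module
      induce endomorphisms of the other ([Sigma_step_brick]);
    - if theta is nonpositive on alpha_i, then N is theta-semistable if and
      only if M is (s_i theta)-semistable ([rp_semistable]).  Among the
      submodules with given components away from i, the sign of
      theta(alpha_i) singles out the worst ones: the largest possible
      component at i in N, the smallest possible one in M.  These are the
      kernel and the image of one map, so their dimension vectors correspond
      under s_i.

    Along a positive expression the dimension at i grows from M to N.  Then
    the in-map of N cannot be surjective, S_i is a quotient of N, and theta is
    nonpositive on alpha_i as soon as N is theta-semistable.  Hence
    Stab N = sigma_i^+ (Stab M), and likewise for the inverse functor
    ([Stab_step]).  As Stab S_j is the hyperplane orthogonal to alpha_j,
    induction on the word shows that each well defined product of reflection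
    functors is a brick of dimension beta whose stability cone is the given
    cone ([Sigma_word_spec]).

    Conversely every brick B of dimension beta is such a product
    ([Sigma_word_exists]).  Unless dim B = alpha_i, the module S_i is not
    both a quotient and a submodule of B, for the composite B -> S_i -> B
    would be a nonzero endomorphism which is not invertible
    ([brick_out_or_in]).  So one of the two functors can be undone, and one
    descends along the expression to a module of dimension alpha_j, which is
    S_j ([simple_iso]).

    The bimodules enter only through the adjunction, given by the trace form,
    between maps from E(j <- i) (x) M_i to M_j and maps from M_i to
    E(i <- j) (x) M_j ([ev_transpose], [transpose_exists]): it shows that the
    out-map at i contains the same information as the structure maps leaving
    i. *)

(** * Linear algebra *)

Section LinearMaps.
Variable F : fieldType.
Implicit Types V W Y Z : vectType F.

Lemma linfun_exists V W (f : V -> W) : linear f -> exists h : 'Hom(V, W), h =1 f.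
Proof.
move=> f_lin; pose fM := GRing.isLinear.Build _ _ _ _ f f_lin.
pose fL : {linear V -> W} := HB.pack f fM.
by exists (linfun fL) => v; rewrite lfunE.
Qed.

Lemma linear_linfunE V W (f : V -> W) : linear f -> linfun f =1 f.
Proof.
move=> f_lin; pose fM := GRing.isLinear.Build _ _ _ _ f f_lin.
pose fL : {linear V -> W} := HB.pack f fM.
exact: (lfunE fL).
Qed.

Lemma lfun_bij V W (f : 'Hom(V, W)) :
  bijective f <-> lker f = 0%VS /\ limg f = fullv.
Proof.
split=> [fbij|[/eqP kf imf]].
  split; first by apply/eqP/lker0P; apply: bij_inj.
  case: fbij => g _ gK; apply/vspaceP => w; rewrite memvf -[w]gK.
  by rewrite memv_img ?memvf.
exists (f^-1)%VF; first exact: lker0_lfunK.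
by move=> w; rewrite limg_lfunVK // imf memvf.
Qed.

Lemma bij_lfunK V W (f : 'Hom(V, W)) : bijective f -> cancel f (f^-1)%VF.
Proof. by move=> /lfun_bij[/eqP kf _]; apply: lker0_lfunK. Qed.

Lemma bij_lfunVK V W (f : 'Hom(V, W)) : bijective f -> cancel (f^-1)%VF f.
Proof. by move=> /lfun_bij[_ imf] w; rewrite limg_lfunVK // imf memvf. Qed.

Lemma bij_lfunV V W (f : 'Hom(V, W)) : bijective f -> bijective (f^-1)%VF.
Proof. by move=> fb; exists f; [apply: bij_lfunVK | apply: bij_lfunK]. Qed.

Lemma lfun_surj V W (f : 'Hom(V, W)) :
  (forall w, exists v, f v = w) <-> limg f = fullv.
Proof.
split=> [fs|imf w]; last by exists (f^-1%VF w); rewrite limg_lfunVK // imf memvf.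
apply/vspaceP => w; rewrite memvf; have [v <-] := fs w.
by rewrite memv_img ?memvf.
Qed.

Lemma dim_limg_inj V W (f : 'Hom(V, W)) (U : {vspace V}) :
  injective f -> \dim (f @: U) = \dim U.
Proof.
by move/lker0P/eqP => kf; rewrite limg_dim_eq // kf capv0.
Qed.

Lemma inj_lfun_bij V (f : 'End(V)) : injective f -> bijective f.
Proof.
move=> finj; have kf : lker f == 0%VS by apply/lker0P.
by apply/lfun_bij; split; [apply/eqP | apply: lker0_limgf].
Qed.

Lemma surj_lfun_inj V (f : 'End(V)) : limg f = fullv -> injective f.
Proof.
move=> imf; apply/lker0P; rewrite -dimv_eq0.
have := limg_ker_dim f fullv; rewrite imf capfv => /eqP.
by rewrite -[X in _ == X]add0n eqn_add2r.
Qed.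

Lemma eq_dim_iso V W : \dim {:V} = \dim {:W} ->
  exists f : 'Hom(V, W), bijective f.
Proof.
move=> eqd; have eqd' : dim V = dim W by rewrite -!dimvf.
have lin : linear (fun v : V => r2v (castmx (erefl, eqd') (v2r v)) : W).
  move=> c v w; rewrite (linearP v2r).
  rewrite (_ : castmx _ _ = c *: castmx (erefl, eqd') (v2r v)
                            + castmx (erefl, eqd') (v2r w)) ?linearP //.
  by apply/matrixP => i j; rewrite !(castmxE, mxE).
have [f fE] := linfun_exists lin; exists f.
exists (fun w => r2v (castmx (esym erefl, esym eqd') (v2r w))) => x.
  by rewrite fE r2vK castmxK v2rK.
by rewrite fE r2vK castmxKV v2rK.
Qed.

End LinearMaps.

Section Family.
Variables (F : fieldType) (n : nat) (X : 'I_n -> vectType F).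
Implicit Types (Y Z : vectType F) (U : forall j, {vspace X j}).

(** The direct sum of the family.  It is made of row vectors because the
    dependent functions on ['I_n] do not form a [vectType]. *)
Definition dsum : vectType F := 'rV[F]_(\sum_j dim (X j)).

Definition pack (t : forall j, X j) : dsum := \mxrow_j v2r (t j).
Definition unpack j (w : dsum) : X j := r2v (submxrow w j).

Lemma packK t j : unpack j (pack t) = t j.
Proof. by rewrite /unpack /pack mxrowK v2rK. Qed.

Lemma unpack_inj w w' : (forall j, unpack j w = unpack j w') -> w = w'.
Proof. by move=> eqw; apply/mxrowP => j; apply/r2v_inj/eqw. Qed.

Lemma unpack_is_linear j : linear (unpack j).
Proof.
move=> c w w'; rewrite /unpack -linearP; congr r2v.
by apply/matrixP => a b; rewrite !mxE.
Qed.
HB.instance Definition _ j :=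
  GRing.isLinear.Build F dsum (X j) *:%R (unpack j) (unpack_is_linear j).

Lemma pack_lfun Z (o : forall j, 'Hom(Z, X j)) :
  exists h : 'Hom(Z, dsum), forall z j, unpack j (h z) = o j z.
Proof.
have lin : linear (fun z => pack (fun j => o j z)).
  by move=> c z z'; apply: unpack_inj => j; rewrite linearP /= !packK linearP.
by have [h hE] := linfun_exists lin; exists h => z j; rewrite hE packK.
Qed.

Lemma unpack_lfun Y (f : forall j, 'Hom(X j, Y)) :
  exists h : 'Hom(dsum, Y), forall w, h w = \sum_j f j (unpack j w).
Proof.
apply: linfun_exists => c w w'.
rewrite scaler_sumr -big_split; apply: eq_bigr => j _ /=.
by rewrite !linearP.
Qed.

End Family.

Lemma dsum_dim (F : fieldType) n (X : 'I_n -> vectType F) :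
  \dim {:dsum X} = \sum_j \dim {:X j}.
Proof.
by rewrite dimvf /dim /= mul1n; apply: eq_bigr => j _; rewrite dimvf.
Qed.

Section Exact.
Variables (F : fieldType) (n : nat) (X : 'I_n -> vectType F).
Variables (Y Z : vectType F).
Implicit Types (U : forall j, {vspace X j}).

(** The direct sum of the [U j], inside that of the [X j]: it is the image of the
    direct sum of the family of spaces [subvs_of (U j)]. *)
Lemma dsum_subspace U :
  exists2 B : {vspace dsum X},
    (forall w, w \in B <-> forall j, unpack j w \in U j)
    & \dim B = \sum_j \dim (U j).
Proof.
have [h hE] := pack_lfun (fun j =>
  linfun vsval \o linfun (@unpack F n (fun k => subvs_of (U k)) j))%VF.
have {}hE w j : unpack j (h w) = vsval (unpack j w).
  by rewrite hE comp_lfunE !lfunE.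
have hinj : injective h.
  move=> w w' eqw; apply: unpack_inj => j; apply: val_inj.
  by rewrite /= -!hE eqw.
exists (limg h); last first.
  rewrite dim_limg_inj // dsum_dim; apply: eq_bigr => j _.
  by rewrite dimvf.
move=> w; split=> [/memv_imgP[w' _ ->] j|Uw]; first by rewrite hE subvsP.
suff -> : w = h (pack (fun j => vsproj (U j) (unpack j w))).
  by rewrite memv_img ?memvf.
by apply: unpack_inj => j; rewrite hE packK vsprojK.
Qed.

Lemma memv_bigcap_preim (o : forall j, 'Hom(Z, X j)) U z :
  reflect (forall j, o j z \in U j) (z \in \bigcap_j (o j @^-1: U j))%VS.
Proof.
rewrite memvE; apply: (iffP subv_bigcapP) => Uz j.
  by have := Uz j isT; rewrite -memvE -memv_preim.
by move=> _; rewrite -memvE -memv_preim.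
Qed.

(** For an exact sequence from [Z] through the direct sum of the [X j] to [Y],
    this is rank-nullity restricted to the direct sum of the [U j]. *)
Lemma exact_dim (f : forall j, 'Hom(X j, Y)) (o : forall j, 'Hom(Z, X j)) U :
  (forall z, (forall j, o j z = 0) -> z = 0) ->
  (forall t : forall j, X j,
     \sum_j f j (t j) = 0 <-> exists z, forall j, o j z = t j) ->
  (\dim (\sum_j f j @: U j)%VS + \dim (\bigcap_j (o j @^-1: U j))%VS
    = \sum_j \dim (U j))%N.
Proof.
move=> o_inj fo0.
have [B BP <-] := dsum_subspace U.
have [g gE] := unpack_lfun f; have [h hE] := pack_lfun o.
have -> : (\sum_j f j @: U j)%VS = (g @: B)%VS.
  apply/vspaceP => y; apply/memv_sumP/memv_imgP => [[ys ysP ->]|[w /BP Bw ->]].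
    have /fin_all_exists[t tP] j : exists x, x \in U j /\ ys j = f j x.
      by have /memv_imgP[x Ux ->] := ysP j isT; exists x.
    exists (pack t); first by apply/BP => j; rewrite packK; case: (tP j).
    by rewrite gE; apply: eq_bigr => j _; rewrite packK; case: (tP j).
  by exists (fun j => f j (unpack j w)); rewrite ?gE // => j _; apply: memv_img.
have hinj : injective h.
  move=> z z' eqz; apply/eqP; rewrite -subr_eq0; apply/eqP/o_inj => j.
  by rewrite linearB /= -!hE eqz subrr.
rewrite -(dim_limg_inj _ hinj) addnC.
suff -> : (h @: \bigcap_j (o j @^-1: U j))%VS = (B :&: lker g)%VS.
  exact: limg_ker_dim.
apply/vspaceP => w; rewrite memv_cap memv_ker gE.
apply/memv_imgP/andP => [[z /memv_bigcap_preim Uz ->]|[/BP Bw /eqP/fo0[z oz]]].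
  split; first by apply/BP => j; rewrite hE; apply: Uz.
  by apply/eqP/fo0; exists z => j; rewrite hE.
exists z; last by apply: unpack_inj => j; rewrite hE oz.
by apply/memv_bigcap_preim => j; rewrite oz; apply: Bw.
Qed.

(** The universal property of [Y] as a cokernel: only the relations among the
    [f j] must hold among the [g j]. *)
Lemma coker_factor (f : forall j, 'Hom(X j, Y)) (g : forall j, 'Hom(X j, Z)) :
  (forall y, exists t : forall j, X j, \sum_j f j (t j) = y) ->
  (forall t : forall j, X j, \sum_j f j (t j) = 0 -> \sum_j g j (t j) = 0) ->
  exists h : 'Hom(Y, Z), forall j x, h (f j x) = g j x.
Proof.
move=> fsurj fg; have [p pE] := unpack_lfun f; have [q qE] := unpack_lfun g.
have pimg : limg p = fullv.
  apply/lfun_surj => y; have [t <-] := fsurj y; exists (pack t).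
  by rewrite pE; apply: eq_bigr => j _; rewrite packK.
suff [h hE] : exists h : 'Hom(Y, Z), forall t : forall j, X j,
    h (\sum_j f j (t j)) = \sum_j g j (t j).
  exists h => j x; have := hE (@dfwith 'I_n (fun k => X k) (fun=> 0) j x).
  rewrite (bigD1 j) //= [in X in _ = X](bigD1 j) //= !dfwith_in.
  by rewrite !big1 ?addr0 // => k njk; rewrite dfwith_out 1?eq_sym // linear0.
exists (q \o p^-1)%VF => t; rewrite comp_lfunE.
set y := \sum_j _; set w := p^-1%VF y.
have pw : p w = y by rewrite limg_lfunVK // pimg memvf.
apply/eqP; rewrite -subr_eq0 qE -sumrB; apply/eqP.
rewrite (eq_bigr (fun j => g j (unpack j w - t j))) => [|j _].
  apply: fg; under eq_bigr do rewrite linearB /=.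
  by rewrite sumrB -pE pw subrr.
by rewrite linearB.
Qed.

Lemma ker_factor (o : forall j, 'Hom(Z, X j)) (g : forall j, 'Hom(Y, X j)) :
  (forall z, (forall j, o j z = 0) -> z = 0) ->
  (forall y, exists z, forall j, o j z = g j y) ->
  exists h : 'Hom(Y, Z), forall y j, o j (h y) = g j y.
Proof.
move=> o_inj og; have [p pE] := pack_lfun o; have [q qE] := pack_lfun g.
exists (p^-1 \o q)%VF => y j; rewrite comp_lfunE.
have [z zE] := og y; have -> : q y = p z.
  by apply: unpack_inj => k; rewrite pE qE zE.
rewrite lker0_lfunK ?zE //; apply/lker0P => w w' eqw.
apply/eqP; rewrite -subr_eq0; apply/eqP/o_inj => k.
by rewrite linearB /= -!pE eqw subrr.
Qed.

End Exact.

Section KerCoker.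
Variables (F : fieldType) (n : nat) (X : 'I_n -> vectType F).

Lemma ker_exists (Y : vectType F) (f : forall j, 'Hom(X j, Y)) :
  exists (Z : vectType F) (o : forall j, 'Hom(Z, X j)),
    (forall z, (forall j, o j z = 0) -> z = 0) /\
    (forall t : forall j, X j,
       \sum_j f j (t j) = 0 <-> exists z, forall j, o j z = t j).
Proof.
have [p pE] := unpack_lfun f.
have /fin_all_exists[o oE] j : exists o : 'Hom(subvs_of (lker p), X j),
    forall z, o z = unpack j (vsval z).
  by exists (linfun (@unpack F n X j) \o linfun vsval)%VF => z;
     rewrite comp_lfunE !lfunE.
exists (subvs_of (lker p)), o; split=> [z z0|t].
  by apply: val_inj; apply: unpack_inj => j; rewrite -oE z0 linear0.
have -> : \sum_j f j (t j) = p (pack t).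
  by rewrite pE; apply: eq_bigr => j _; rewrite packK.
split=> [pt|[z zE]].
  exists (vsproj (lker p) (pack t)) => j.
  by rewrite oE vsprojK ?packK // memv_ker pt.
suff -> : pack t = vsval z by apply/eqP; rewrite -memv_ker subvsP.
by apply: unpack_inj => j; rewrite packK -zE oE.
Qed.

Lemma coker_exists (Z : vectType F) (o : forall j, 'Hom(Z, X j)) :
  exists (Y : vectType F) (f : forall j, 'Hom(X j, Y)),
    (forall y, exists t : forall j, X j, \sum_j f j (t j) = y) /\
    (forall t : forall j, X j,
       \sum_j f j (t j) = 0 <-> exists z, forall j, o j z = t j).
Proof.
have [p pE] := pack_lfun o; pose U := (limg p)^C%VS.
(* the cokernel of [p] is realised as a complement of its image, onto which
   [w |-> w - projv (limg p) w] projects *)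
have [q qE] : exists q : 'Hom(dsum X, subvs_of U),
    forall w, vsval (q w) = w - projv (limg p) w.
  exists (linfun (vsproj U) \o (\1 - projv (limg p)))%VF => w.
  by rewrite comp_lfunE lfunE /= add_lfunE opp_lfunE id_lfunE vsprojK ?memv_projC.
have qker w : q w = 0 <-> w \in limg p.
  split=> [/(congr1 vsval)|wp]; last first.
    by apply: val_inj; rewrite /= qE projv_id // subrr.
  by rewrite qE linear0 => /eqP; rewrite subr_eq0 => /eqP->; apply: memv_proj.
have [i iE] : exists i : forall j, 'Hom(X j, dsum X), forall t : forall j, X j,
    \sum_j i j (t j) = pack t.
  have /fin_all_exists[i iE] j : exists i : 'Hom(X j, dsum X),
      forall x k, unpack k (i x) = @dfwith 'I_n (fun k => X k) (fun=> 0) j x k.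
    have /fin_all_exists[d dE] k : exists d : 'Hom(X j, X k),
        forall x, d x = @dfwith 'I_n (fun k => X k) (fun=> 0) j x k.
      apply: linfun_exists => c x y; case: (eqVneq j k) => [<-|njk].
        by rewrite !dfwith_in.
      by rewrite !dfwith_out // scaler0 addr0.
    by have [h hE] := pack_lfun d; exists h => x k; rewrite hE dE.
  exists i => t; apply: unpack_inj => k; rewrite packK linear_sum /=.
  rewrite (bigD1 k) //= iE dfwith_in big1 ?addr0 // => j njk.
  by rewrite iE dfwith_out.
have qi t : \sum_j (q \o i j)%VF (t j) = q (pack t).
  by rewrite -iE linear_sum; apply: eq_bigr => j _; rewrite comp_lfunE.
exists (subvs_of U), (fun j => q \o i j)%VF; split=> [y|t].
  exists (fun j => unpack j (vsval y)); rewrite qi.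
  have -> : pack (fun j => unpack j (vsval y)) = vsval y.
    by apply: unpack_inj => j; rewrite packK.
  apply: val_inj; rewrite /= qE -[RHS]subr0; congr (_ - _).
  by apply/eqP; rewrite -memv_ker lker_proj subvsP.
rewrite qi qker; split=> [/memv_imgP[z _ tz]|[z zE]].
  by exists z => j; rewrite -pE -tz packK.
suff -> : pack t = p z by rewrite memv_img ?memvf.
by apply: unpack_inj => j; rewrite packK pE zE.
Qed.

End KerCoker.

(** * Tensor products *)

Section TensorMore.
Variables (kappa : fieldType) (K : fieldExtType kappa) (E F D : {subfield K}).
Variable N : nat.
Hypotheses (sED : (E <= D)%VS) (sFD : (F <= D)%VS).
Implicit Types (V W : vectType (subvs_of F)).

Lemma tens_ind V (P : tens E D N V -> Prop) :
  P 0 -> (forall t u, P t -> P u -> P (t + u)) ->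
  (forall a x v, x \in D -> P (pure E D a x v)) -> forall t, P t.
Proof.
move=> P0 PD Ppure t; rewrite (pure_sum sED sFD t).
by apply: big_ind => // p _; apply: Ppure; apply: tens_val_in.
Qed.

Lemma tens_map_linear V W (f : 'Hom(V, W)) :
  linear (tens_map f : tens E D N V -> tens E D N W).
Proof.
pose g b y w : tens E D N W := pure E D b y (f w).
have [||||h [hE _]] := @tens_universal _ _ E F D N sED sFD V (tens E D N W) g.
- by move=> *; apply: pureDl.
- by move=> *; rewrite /g linearD; apply: pureDr.
- by move=> *; rewrite /g linearZ; apply: pure_bal.
- by move=> *; apply: pureZ.
have tE t : tens_map f t = h t.
  rewrite [in RHS](pure_sum sED sFD t) linear_sum; apply: eq_bigr => p _.
  by apply/esym/hE; apply: tens_val_in.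
by move=> c t u; rewrite !tE linearP.
Qed.

Lemma dim_tens V : \dim {:tens E D N V} = (N * \dim {:V} * \dim (vspaceOver E D))%N.
Proof.
by rewrite dimvf /tens /dim /= /dim /= card_prod !card_ord.
Qed.

Lemma tens_pure0r V a x : x \in D -> pure E D a x (0 : V) = 0 :> tens E D N V.
Proof. by move=> Dx; apply: (addrI (pure E D a x 0)); rewrite -pureDr // !addr0. Qed.

Lemma tens_pure_suml V a (v : V) m (x : 'I_m -> K) : (forall k, x k \in D) ->
  pure E D a (\sum_k x k) v = \sum_k pure E D a (x k) v :> tens E D N V.
Proof.
move=> Dx; have pl0 : pure E D a 0 v = 0 :> tens E D N V.
  by apply: (addrI (pure E D a 0 v)); rewrite -pureDl ?mem0v // !addr0.
apply: proj2 (_ : \sum_k x k \in D /\ _).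
apply: (big_rec2 (fun y t => y \in D /\ pure E D a y v = t)) => [|k y t _ [Dy <-]].
  by rewrite mem0v.
by rewrite rpredD // pureDl.
Qed.

(** For a trace [tr] from [D] to [F], the tensors [x (x) v] in the summand [c]
    can be paired with [y] in [D], with value [tr (y * x) *: v]. *)
Section Evaluation.
Variable tr : K -> subvs_of F.
Hypothesis trD : forall x y, tr (x + y) = tr x + tr y.
Hypothesis trZ : forall (c : subvs_of F) x, x \in D -> tr (vsval c * x) = c * tr x.

Definition tens_ev V (c : 'I_N) (y : K) (t : tens E D N V) : V :=
  \sum_(l < \dim {:V}) tr (y * vsval (t (c, l))) *: (vbasis {:V})`_l.

Lemma tens_evD V c y (t u : tens E D N V) :
  tens_ev c y (t + u) = tens_ev c y t + tens_ev c y u.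
Proof.
rewrite -big_split; apply: eq_bigr => l _ /=.
by rewrite ffunE /= mulrDr trD scalerDl.
Qed.

Let tr0 : tr 0 = 0.
Proof. by apply: (addrI (tr 0)); rewrite -trD !addr0. Qed.

Lemma tens_ev0 V c y : tens_ev c y (0 : tens E D N V) = 0.
Proof. by apply: (addrI (tens_ev c y 0)); rewrite -tens_evD !addr0. Qed.

Lemma tens_ev_sum V c y I (r : seq I) (P : pred I) (t : I -> tens E D N V) :
  tens_ev c y (\sum_(k <- r | P k) t k) = \sum_(k <- r | P k) tens_ev c y (t k).
Proof. by apply: (big_morph _ (tens_evD c y) (tens_ev0 _ c y)). Qed.

Lemma tens_ev_pure V c y a x (v : V) : x \in D -> y \in D ->
  tens_ev c y (pure E D a x v) = (if a == c then tr (y * x) *: v else 0).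
Proof.
move=> Dx Dy; rewrite /tens_ev.
case: (eqVneq a c) => [->|nac]; last first.
  by apply: big1 => l _; rewrite val_pure //= eq_sym (negPf nac) mulr0 tr0 scale0r.
rewrite [in RHS](coord_vbasis (memvf v)) scaler_sumr; apply: eq_bigr => l _.
rewrite val_pure //= eqxx mulrA [_ * vsval _]mulrC trZ ?memvM // scalerA.
by rewrite /GRing.scale /= mulrC.
Qed.

Lemma tens_ev_nat V W (f : 'Hom(V, W)) c y (t : tens E D N V) : y \in D ->
  f (tens_ev c y t) = tens_ev c y (tens_map f t).
Proof.
move=> Dy; have [h hE] := linfun_exists (tens_map_linear f); rewrite -hE.
elim/tens_ind: t => [|t u IHt IHu|a x v Dx].
- by rewrite linear0 !tens_ev0 linear0.
- by rewrite linearD !tens_evD linearD /= IHt IHu.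
- rewrite hE tens_map_pure // !tens_ev_pure //.
  by case: eqP; rewrite ?linear0 ?linearZ.
Qed.

Lemma tens_evDl V c y z (t : tens E D N V) :
  tens_ev c (y + z) t = tens_ev c y t + tens_ev c z t.
Proof.
rewrite -big_split; apply: eq_bigr => l _ /=.
by rewrite mulrDl trD scalerDl.
Qed.

Lemma tens_evZl V c y (f : subvs_of F) (t : tens E D N V) : y \in D ->
  tens_ev c (vsval f * y) t = f *: tens_ev c y t.
Proof.
move=> Dy; rewrite scaler_sumr; apply: eq_bigr => l _.
by rewrite -mulrA trZ ?scalerA // memvM // tens_val_in.
Qed.

Lemma tens_evZr V c y (e : subvs_of E) (t : tens E D N V) :
  tens_ev c (y * vsval e) t = tens_ev c y (e *: t).
Proof.
by apply: eq_bigr => l _; rewrite ffunE /= fieldOver_scaleE mulrA.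
Qed.

(** The third hypothesis says that [b] and [b'] are dual bases for the trace
    form; the pairings with the elements of [b] are then the coordinates of a
    tensor with respect to [b']. *)
Lemma tens_ev_expand V (m : nat) (b b' : seq K) (t : tens E D N V) :
  (forall k, (k < m)%N -> b`_k \in D) -> (forall k, (k < m)%N -> b'`_k \in D) ->
  (forall z, z \in D -> \sum_(k < m) b'`_k * vsval (tr (b`_k * z)) = z) ->
  \sum_c \sum_(k < m) pure E D c b'`_k (tens_ev c b`_k t) = t.
Proof.
move=> Db Db' exp; elim/tens_ind: t => [|t u IHt IHu|a x v Dx].
- apply: big1 => c _; apply: big1 => k _; rewrite tens_ev0.
  by rewrite tens_pure0r ?Db'.
- rewrite -[in RHS]IHt -[in RHS]IHu -big_split; apply: eq_bigr => c _ /=.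
  by rewrite -big_split; apply: eq_bigr => k _ /=; rewrite tens_evD pureDr ?Db'.
rewrite (bigD1 a) //= [X in _ + X]big1 ?addr0 => [|c nca]; last first.
  apply: big1 => k _; rewrite tens_ev_pure ?Db // eq_sym (negPf nca).
  by rewrite tens_pure0r ?Db'.
rewrite -[in RHS](exp x Dx) tens_pure_suml => [|k]; last first.
  by rewrite memvM ?Db' // (subvP sFD) ?subvsP.
apply: eq_bigr => k _; rewrite tens_ev_pure ?Db // eqxx.
by rewrite pure_bal ?Db'.
Qed.

End Evaluation.
End TensorMore.

(** * Subfields of a cyclic extension *)

Section CyclicSubfields.
Variables (kappa : fieldType) (K : splittingFieldType kappa).
Hypothesis K_galois : galois 1%VS {:K}%VS.
Hypothesis K_cyclic : cyclic 'Gal({:K}%VS / 1%VS)%g.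
Implicit Types E : {subfield K}.

Lemma galois_over E : galois E {:K}.
Proof. by apply: galoisS K_galois; rewrite sub1v subvf. Qed.

(** By the Galois correspondence, since a cyclic group has one subgroup of each
    possible order. *)
Lemma subfield_dvd E1 E2 : (\dim E1 %| \dim E2)%N -> (E1 <= E2)%VS.
Proof.
move=> d12; rewrite -(galois_fixedField (galois_over E1)).
rewrite -(galois_fixedField (galois_over E2)); apply: fixedFieldS.
have sub E : ('Gal({:K} / E) \subset 'Gal({:K} / 1))%g by rewrite galS ?sub1v.
rewrite -(cardSg_cyclic K_cyclic (sub E2) (sub E1)).
rewrite -!galois_dim ?galois_over //.
have [k1 dK1] := dvdnP (field_dimS (subvf E1)).
have [k2 dK2] := dvdnP (field_dimS (subvf E2)).
rewrite [X in (X %/ \dim E2)%N]dK2 [X in (X %/ \dim E1)%N]dK1 !mulnK ?adim_gt0 //.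
have [q d2] := dvdnP d12; apply/dvdnP; exists q.
apply/eqP; rewrite -(eqn_pmul2r (adim_gt0 E1)) -dK1 dK2 d2.
by rewrite mulnA [(q * _)%N]mulnC.
Qed.

(** All subgroups of an abelian group are normal. *)
Lemma galois_sub E1 E2 : (E1 <= E2)%VS -> galois E1 E2.
Proof.
move=> s12; rewrite -[X in galois _ X](galois_fixedField (galois_over E2)).
apply: (@normal_fixedField_galois _ _ {:K}%AS E1 (galois_over E1) 'Gal({:K} / E2)%G).
have sub E : ('Gal({:K} / E) \subset 'Gal({:K} / 1))%g by rewrite galS ?sub1v.
rewrite /normal galS //= sub_abelian_norm ?galS //.
exact: abelianS (sub E1) (cyclic_abelian K_cyclic).
Qed.

Lemma galTraceZ E1 E2 c x : c \in E1 -> x \in E2 -> (E1 <= E2)%VS ->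
  galTrace E1 E2 (c * x) = c * galTrace E1 E2 x.
Proof.
move=> E1c E2x s12; rewrite /galTrace mulr_sumr; apply: eq_bigr => g gE.
by rewrite rmorphM /= (fixed_gal s12 gE).
Qed.

End CyclicSubfields.

(** * Reflections and positive expressions *)

Section Reflections.
Variables (R : realType) (n : nat) (C : cartan_datum n).
Local Notation form := Defs.form.
Local Notation Vdual := 'Hom('rV[R]_n, R^o).
Implicit Types (i : 'I_n) (x v w : 'rV[R]_n) (theta : Vdual).

Lemma form_corootE i x :
  form C (coroot R C i) x = \sum_j (cartan C i j)%:~R * x 0 j.
Proof.
rewrite /form (bigD1 i) //= [X in _ + X]big1 ?addr0 => [|k nki]; last first.
  by apply: big1 => j _; rewrite !mxE (negPf nki) andbF mulr0 !mul0r.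
apply: eq_bigr => j _; rewrite !mxE !eqxx mulr1 intrM mulrAC mulrA mulVf ?mul1r //.
by rewrite pnatr_eq0 -lt0n dsym_gt0.
Qed.

Lemma form_coroot_refl i x :
  form C (coroot R C i) (refl C i x) = - form C (coroot R C i) x.
Proof.
rewrite /refl -scaleNr addrC form_is_linear form_coroot_alpha.
by rewrite /GRing.scale /= mulNr mulr_natr mulr2n opprD addrNK.
Qed.

(** A form of the reflection formula without subtraction, in which it comes out
    of rank-nullity. *)
Lemma refl_of_coords i v w :
  (forall k, k != i -> v 0 k = w 0 k) ->
  v 0 i + w 0 i = \sum_(j | j != i) (absz (cartan C i j))%:R * w 0 j ->
  v = refl C i w.
Proof.
move=> vw vwi; apply/rowP => k; rewrite /refl form_corootE !mxE eqxx /=.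
case: (eqVneq k i) => [->|nki]; last by rewrite mulr0 subr0 vw.
rewrite mulr1 (bigD1 i) //= cartan_diag; apply: (addIr (w 0 i)); rewrite vwi.
rewrite opprD addrA mulr_natl mulr2n opprD addrA subrr add0r addrAC addNr add0r.
rewrite -sumrN; apply: eq_bigr => j nji; rewrite -mulNr; congr (_ * _).
rewrite -mulrNz -[(absz _)%:R]/((Posz (absz (cartan C i j)))%:~R).
by rewrite abszE ler0_norm // cartan_offdiag // eq_sym.
Qed.

Lemma dual_reflD i theta x : dual_refl C i theta x = theta (refl C i x).
Proof. by rewrite /dual_refl comp_lfunE lfunE. Qed.

Lemma dual_reflK i : involutive (dual_refl C i : Vdual -> Vdual).
Proof. by move=> theta; apply/lfunP => x; rewrite !dual_reflD reflK. Qed.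

Lemma refl_alpha i : refl C i (alpha R i) = - alpha R i.
Proof.
by rewrite /refl form_coroot_alpha scaler_nat mulr2n opprD addNKr.
Qed.

Lemma dual_refl_alpha i theta : dual_refl C i theta (alpha R i) = - theta (alpha R i).
Proof. by rewrite dual_reflD refl_alpha linearN. Qed.

Lemma sigma_coneE (e : bool) i (X : set Vdual) theta :
  sigma_cone C e i X theta <->
  X (dual_refl C i theta) /\
  (if e then theta (alpha R i) <= 0 else 0 <= theta (alpha R i)).
Proof.
split=> [[eta [Xe sgn_eta] <-]|[Xt sgn_t]].
  rewrite dual_reflK; split=> //; rewrite dual_refl_alpha.
  by case: e sgn_eta => /=; rewrite ?oppr_le0 ?oppr_ge0.
exists (dual_refl C i theta); last exact: dual_reflK.
split=> //=; rewrite dual_refl_alpha.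
by case: e sgn_t => /=; rewrite ?oppr_le0 ?oppr_ge0.
Qed.

Lemma positive_expression_form s j v s1 i s2 :
  positive_expression C s j v -> s = s1 ++ i :: s2 ->
  0 < form C (coroot R C i) (apply_word C (rcons s1 i) (alpha R j)).
Proof.
move=> [_ pos] /pos[c c0 /rowP/(_ i)]; set g := apply_word C s1 _.
have -> : apply_word C (rcons s1 i) (alpha R j) = refl C i g.
  by rewrite /apply_word -cats1 foldl_cat.
rewrite form_coroot_refl !mxE !eqxx !mulr1 addrAC subrr add0r => ->.
exact: c0.
Qed.

Lemma positive_expression_rcons s i j v :
  positive_expression C (rcons s i) j v ->
  [/\ positive_expression C s j (apply_word C s (alpha R j)),
      v = refl C i (apply_word C s (alpha R j))
    & 0 < form C (coroot R C i) v].
Proof.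
move=> posv; have [vE pos] := posv; split.
- by split=> // s1 k s2 sE; apply: pos; rewrite sE rcons_cat.
- by rewrite vE /apply_word -cats1 foldl_cat.
- by rewrite vE; apply: (positive_expression_form (s2 := [::]) posv); rewrite cats1.
Qed.

(** Each step of a positive expression increases one coordinate, and the first
    vector is a simple root. *)
Lemma positive_expression_ge0 s j v :
  positive_expression C s j v -> forall k, 0 <= v 0 k.
Proof.
elim/last_ind: s v => [|s i IHs] v.
  by move=> [-> _] k; rewrite mxE; case: (_ && _).
move=> /positive_expression_rcons[/IHs]; set g := apply_word _ _ _.
move=> g_ge0 -> + k; rewrite form_coroot_refl => g_lt0.
by rewrite /refl !mxE -mulNr addr_ge0 ?g_ge0 // mulr_ge0 ?ler0n // ltW.
Qed.

End Reflections.

(** * Tensoring with an edge *)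

Section PreprojectiveModules.
Variables (n : nat) (C : cartan_datum n).
Variables (kappa : fieldType) (K : splittingFieldType kappa).
Hypothesis K_galois : galois 1%VS {:K}%VS.
Hypothesis K_cyclic : cyclic 'Gal({:K}%VS / 1%VS)%g.
Variable D : preproj_datum C K.

Local Notation kap i := (subfld D (dsym C i)).
Local Notation kap2 i j := (subfld D (dlcm C i j)).

Lemma kap2C i j : kap2 i j = kap2 j i.
Proof. by rewrite /dlcm lcmnC. Qed.

Lemma dsym_dvd_total i : (dsym C i %| total_lcm C)%N.
Proof. by rewrite /total_lcm (bigD1 i) //= dvdn_lcml. Qed.

Lemma dim_kap i : \dim (kap i) = dsym C i.
Proof. by apply: subfld_dim; apply: dsym_dvd_total. Qed.

Lemma dim_kap2 i j : \dim (kap2 i j) = dlcm C i j.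
Proof. by apply: subfld_dim; rewrite dvdn_lcm !dsym_dvd_total. Qed.

Lemma kap_subl i j : (kap i <= kap2 i j)%VS.
Proof.
by apply: (subfield_dvd K_galois K_cyclic); rewrite dim_kap dim_kap2 dvdn_lcml.
Qed.

Lemma kap_subr i j : (kap j <= kap2 i j)%VS.
Proof. by rewrite kap2C kap_subl. Qed.

Section Functor.
Variables (j i : 'I_n).
Implicit Types U V W : vectType (subvs_of (kap i)).

Lemma edge_ind U (P : edge j U -> Prop) :
  P 0 -> (forall t u, P t -> P u -> P (t + u)) ->
  (forall a x u, x \in kap2 i j -> P (epure a x u)) -> forall t, P t.
Proof. exact: (tens_ind (kap_subr i j) (kap_subl i j)). Qed.

Definition edge_lfun U V (f : 'Hom(U, V)) : 'Hom(edge j U, edge j V) :=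
  linfun (edge_map f).

Lemma edge_lfunE U V (f : 'Hom(U, V)) t : edge_lfun f t = edge_map f t.
Proof.
exact: (linear_linfunE (tens_map_linear (kap_subr i j) (kap_subl i j) f)).
Qed.

Lemma edge_lfun_pure U V (f : 'Hom(U, V)) a x u : x \in kap2 i j ->
  edge_lfun f (epure a x u) = epure a x (f u).
Proof.
move=> Dx; rewrite edge_lfunE.
by apply: tens_map_pure; rewrite ?kap_subr ?kap_subl.
Qed.

Lemma eq_edge_lfun U (W : vectType (subvs_of (kap j)))
    (f g : 'Hom(edge j U, W)) :
  (forall a x u, x \in kap2 i j -> f (epure a x u) = g (epure a x u)) ->
  f =1 g.
Proof.
move=> fg t; elim/edge_ind: t => [|t u ft fu|]; last exact: fg.
  by rewrite !linear0.
by rewrite !linearD /= ft fu.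
Qed.

Lemma edge_lfun_comp U V W (g : 'Hom(V, W)) (f : 'Hom(U, V)) t :
  edge_lfun (g \o f)%VF t = edge_lfun g (edge_lfun f t).
Proof.
rewrite -[RHS]comp_lfunE; move: t; apply: eq_edge_lfun => a x u Dx.
by rewrite !comp_lfunE !edge_lfun_pure // comp_lfunE.
Qed.

Lemma edge_lfun1 U t : edge_lfun (\1%VF : 'End(U)) t = t.
Proof.
rewrite -[RHS]id_lfunE; move: t; apply: eq_edge_lfun => a x u Dx.
by rewrite edge_lfun_pure // !id_lfunE.
Qed.

Lemma epureDr U a x (u v : U) : x \in kap2 i j ->
  epure a x (u + v) = epure a x u + epure a x v :> edge j U.
Proof. exact: (pureDr (kap_subr i j) (kap_subl i j)). Qed.

Lemma epure_bal U a x (c : subvs_of (kap i)) (u : U) : x \in kap2 i j ->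
  epure a (x * vsval c) u = epure a x (c *: u) :> edge j U.
Proof. exact: (pure_bal (kap_subr i j) (kap_subl i j)). Qed.

Lemma epureZ U a x (c : subvs_of (kap j)) (u : U) : x \in kap2 i j ->
  epure a (vsval c * x) u = c *: epure a x u :> edge j U.
Proof. exact: (pureZ (kap_subr i j) (kap_subl i j)). Qed.

Lemma epure0r U a x : x \in kap2 i j -> epure a x (0 : U) = 0 :> edge j U.
Proof. exact: (tens_pure0r (kap_subr i j) (kap_subl i j)). Qed.

Lemma edge_lfun0 U V t : edge_lfun (0 : 'Hom(U, V)) t = 0.
Proof.
transitivity ((0 : 'Hom(edge j U, edge j V)) t); last by rewrite zero_lfunE.
move: t; apply: eq_edge_lfun => a x u Dx.
by rewrite edge_lfun_pure // !zero_lfunE epure0r.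
Qed.

(** An injective map has a left inverse, and functors preserve these. *)
Lemma edge_lfun_inj U V (f : 'Hom(U, V)) : injective f -> injective (edge_lfun f).
Proof.
move=> /lker0P kf t u eqtu; rewrite -[t]edge_lfun1 -[u]edge_lfun1.
by rewrite -(lker0_compVf kf) !edge_lfun_comp eqtu.
Qed.

Lemma edge_lfun_bij U V (f : 'Hom(U, V)) : bijective f -> bijective (edge_lfun f).
Proof.
move=> fb; exists (edge_lfun f^-1%VF) => t; rewrite -edge_lfun_comp.
  rewrite -[RHS]edge_lfun1; congr (edge_lfun _ t); apply/lfunP => u.
  by rewrite comp_lfunE id_lfunE bij_lfunK.
rewrite -[RHS]edge_lfun1; congr (edge_lfun _ t); apply/lfunP => u.
by rewrite comp_lfunE id_lfunE bij_lfunVK.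
Qed.

Lemma edge_lfunV U V (f : 'Hom(U, V)) t : bijective f ->
  edge_lfun f (edge_lfun f^-1%VF t) = t.
Proof.
move=> fb; rewrite -edge_lfun_comp -[RHS]edge_lfun1; congr (edge_lfun _ t).
by apply/lfunP => u; rewrite comp_lfunE id_lfunE bij_lfunVK.
Qed.

(** The number of arrows times the degree of [kap2 i j] over [kap j] is
    [- cartan C j i], by the symmetry of [dsym C i * cartan C i j]. *)
Lemma dim_edge U : j != i ->
  \dim {:edge j U} = (absz (cartan C j i) * \dim {:U})%N.
Proof.
move=> nji; rewrite dim_tens ?kap_subr // mulnAC; congr (_ * _)%N.
rewrite dim_aspaceOver ?kap_subr // dim_kap dim_kap2 /narrows eq_sym (negPf nji).
have dl : (dlcm C i j %| absz ((dsym C i)%:Z * cartan C i j)%R)%N.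
  rewrite dvdn_lcm abszM absz_nat dvdn_mulr //=.
  by rewrite -[dsym C i]absz_nat -abszM cartan_sym abszM absz_nat dvdn_mulr.
rewrite muln_divA ?dvdn_lcmr // divnK //.
by rewrite cartan_sym abszM absz_nat mulKn // dsym_gt0.
Qed.

End Functor.

Lemma edge_self i (U : vectType (subvs_of (kap i))) (t : edge i U) : t = 0.
Proof.
elim/edge_ind: t => [|t u -> ->|[a lt_a]] //; first by rewrite addr0.
by exfalso; move: lt_a; rewrite /narrows eqxx.
Qed.

Lemma edge_self_eq i (U : vectType (subvs_of (kap i))) (t u : edge i U) : t = u.
Proof. by rewrite (edge_self t) (edge_self u). Qed.

Lemma edge_self_vspace i (U : vectType (subvs_of (kap i)))
  (S S' : {vspace edge i U}) : S = S'.
Proof.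
apply/eqP; rewrite eqEsubv; apply/andP.
by split; apply/subvP => t _; rewrite (edge_self t) mem0v.
Qed.

(** * Subspaces generated by tensors *)

Section EdgeSub.
Variables (j i : 'I_n).
Implicit Types U V W : vectType (subvs_of (kap i)).

(** The tensor product of the edge with the subspace [S], realised inside
    [edge j U] as the image of an idempotent so as to avoid subtypes. *)
Definition edge_sub U (S : {vspace U}) : {vspace edge j U} :=
  limg (edge_lfun j (projv S)).

Lemma edge_subP U (S : {vspace U}) t :
  reflect (edge_lfun j (projv S) t = t) (t \in edge_sub S).
Proof.
apply: (iffP memv_imgP) => [[u _ ->]|<-]; last by exists t; rewrite ?memvf.
rewrite -edge_lfun_comp; congr (edge_lfun j _ u); apply/lfunP => v.
by rewrite comp_lfunE projv_proj.
Qed.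

Lemma mem_edge_sub_pure U (S : {vspace U}) a x u :
  x \in kap2 i j -> u \in S -> epure a x u \in edge_sub S.
Proof.
by move=> Dx Su; apply/edge_subP; rewrite edge_lfun_pure // projv_id.
Qed.

Lemma edge_sub_ind U (S : {vspace U}) (P : edge j U -> Prop) :
  P 0 -> (forall t u, P t -> P u -> P (t + u)) ->
  (forall a x u, x \in kap2 i j -> u \in S -> P (epure a x u)) ->
  forall t, t \in edge_sub S -> P t.
Proof.
move=> P0 PD Pp t /edge_subP <-; elim/edge_ind: t => [|t u Pt Pu|a x u Dx].
- by rewrite linear0.
- by rewrite linearD; apply: PD.
- by rewrite edge_lfun_pure //; apply: Pp => //; apply: memv_proj.
Qed.

Lemma mem_edge_sub_img U V (f : 'Hom(U, V)) (S : {vspace U}) t :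
  t \in edge_sub S -> edge_lfun j f t \in edge_sub (f @: S).
Proof.
elim/edge_sub_ind => [|u v Su Sv|a x u Dx Su].
- by rewrite linear0 mem0v.
- by rewrite linearD memvD.
- by rewrite edge_lfun_pure // mem_edge_sub_pure // memv_img.
Qed.

Lemma edge_sub_img U V (f : 'Hom(U, V)) (S : {vspace U}) :
  edge_sub (f @: S) = (edge_lfun j f @: edge_sub S)%VS.
Proof.
apply/eqP; rewrite eqEsubv; apply/andP; split; apply/subvP => t; last first.
  by case/memv_imgP => u Su ->; apply: mem_edge_sub_img.
elim/edge_sub_ind => [|u v Su Sv|a x _ Dx /memv_imgP[u Su ->]].
- exact: mem0v.
- exact: memvD.
- by rewrite -edge_lfun_pure // memv_img // mem_edge_sub_pure.
Qed.

Lemma edge_sub_full U : edge_sub (fullv : {vspace U}) = fullv.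
Proof.
apply/vspaceP => t; rewrite memvf; apply/edge_subP.
rewrite -[RHS]edge_lfun1; congr (edge_lfun j _ t); apply/lfunP => u.
by rewrite projv_id ?memvf // id_lfunE.
Qed.

Lemma dim_edge_sub U (S : {vspace U}) : j != i ->
  \dim (edge_sub S) = (absz (cartan C j i) * \dim S)%N.
Proof.
move=> nji; pose f := linfun (vsval : subvs_of S -> U).
have finj : injective f by move=> u v; rewrite !lfunE; apply: val_inj.
have -> : S = limg f.
  apply/vspaceP => u; apply/idP/memv_imgP => [Su|[v _ ->]].
    by exists (vsproj S u); rewrite ?memvf // lfunE /= vsprojK.
  by rewrite lfunE subvsP.
rewrite edge_sub_img edge_sub_full !dim_limg_inj //; last exact: edge_lfun_inj.
by rewrite dim_edge.
Qed.

End EdgeSub.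

(** * Trace and adjunction *)

Section Adjunction.
Variables (i j : 'I_n).
Hypothesis nij : i != j.

Definition edge_tr (x : K) : subvs_of (kap j) :=
  vsproj (kap j) (galTrace (kap j) (kap2 j i) x).

Lemma edge_trD x y : edge_tr (x + y) = edge_tr x + edge_tr y.
Proof. by rewrite /edge_tr raddfD /= linearD. Qed.

Lemma val_edge_tr x : x \in kap2 i j ->
  vsval (edge_tr x) = galTrace (kap j) (kap2 i j) x.
Proof.
move=> Dx; rewrite /edge_tr kap2C vsprojK //.
by apply: mem_galTrace => //; apply: (galois_sub K_galois K_cyclic); apply: kap_subr.
Qed.

Lemma edge_trZ (c : subvs_of (kap j)) x : x \in kap2 j i ->
  edge_tr (vsval c * x) = c * edge_tr x.
Proof.
move=> Dx; have Dcx : vsval c * x \in kap2 i j.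
  by rewrite memvM //; [apply: (subvP (kap_subr i j)); apply: subvsP | rewrite kap2C].
apply: val_inj; rewrite /= !val_edge_tr // 1?kap2C //.
by rewrite (galTraceZ (K := K)) ?subvsP ?kap_subl.
Qed.

Definition ev (Y : vectType (subvs_of (kap j))) (c : 'I_(narrows C j i)) (y : K)
  (t : edge i Y) : Y := tens_ev edge_tr c y t.

Implicit Types (Y : vectType (subvs_of (kap j))).

Lemma evD Y c y (t u : edge i Y) : ev c y (t + u) = ev c y t + ev c y u.
Proof. exact: (tens_evD edge_trD). Qed.

Lemma evDl Y c y z (t : edge i Y) : ev c (y + z) t = ev c y t + ev c z t.
Proof. exact: (tens_evDl edge_trD). Qed.

Lemma evZl Y c y (f : subvs_of (kap j)) (t : edge i Y) : y \in kap2 j i ->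
  ev c (vsval f * y) t = f *: ev c y t.
Proof. exact: (tens_evZl (kap_subr j i) edge_trZ). Qed.

Lemma evZr Y c y (e : subvs_of (kap i)) (t : edge i Y) :
  ev c (y * vsval e) t = ev c y (e *: t).
Proof. exact: tens_evZr. Qed.

Lemma ev_sum Y c y I (r : seq I) (P : pred I) (t : I -> edge i Y) :
  ev c y (\sum_(k <- r | P k) t k) = \sum_(k <- r | P k) ev c y (t k).
Proof. exact: (tens_ev_sum edge_trD). Qed.

Lemma ev_pure Y c y a x (v : Y) : x \in kap2 j i -> y \in kap2 j i ->
  ev c y (epure a x v : edge i Y) = (if a == c then edge_tr (y * x) *: v else 0).
Proof.
exact: (tens_ev_pure (kap_subr j i) (kap_subl j i) edge_trD edge_trZ).
Qed.

Lemma ev_nat Y Y' (f : 'Hom(Y, Y')) c y (t : edge i Y) : y \in kap2 j i ->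
  f (ev c y t) = ev c y (edge_lfun i f t).
Proof.
move=> Dy; rewrite edge_lfunE.
exact: (tens_ev_nat (kap_subr j i) (kap_subl j i) edge_trD edge_trZ).
Qed.

Lemma bas_mem k : (k < size (bas D j i))%N -> (bas D j i)`_k \in kap2 i j.
Proof.
move=> ltk; rewrite -(mem_aspaceOver (kap_subr i j)).
by apply: (basis_mem (basP D nij)); apply: mem_nth.
Qed.

Lemma dual_bas_memP k : (k < size (bas D j i))%N -> (dual_bas D j i)`_k \in kap2 i j.
Proof. by move=> ltk; apply: (dual_bas_mem nij); rewrite mem_nth // size_dual_bas. Qed.

Lemma bas_expand y : y \in kap2 i j ->
  \sum_(k < size (bas D j i))
    vsval (edge_tr (y * (dual_bas D j i)`_k)) * (bas D j i)`_k = y.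
Proof.
move=> Dy; set b := bas D j i.
have yE := coord_basis (X := in_tuple (b : seq (fieldOver (kap j)))) (basP D nij).
have {yE} := yE y; rewrite (mem_aspaceOver (kap_subr i j)) => /(_ Dy) yE.
rewrite [RHS]yE; apply: eq_bigr => k _.
rewrite fieldOver_scaleE; congr (vsval _ * _).
have Dbk (l : 'I_(size b)) : b`_l \in kap2 i j by apply: bas_mem.
have Ddk (l : 'I_(size b)) : (dual_bas D j i)`_l \in kap2 i j by apply: dual_bas_memP.
have Dc (c : subvs_of (kap j)) : vsval c \in kap2 i j.
  by apply: (subvP (kap_subr i j)); apply: subvsP.
apply: val_inj => /=; rewrite val_edge_tr ?memvM //.
rewrite {1}yE mulr_suml raddf_sum /= (bigD1 k) //= big1 ?addr0 => [|l nlk].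
  rewrite fieldOver_scaleE -mulrA (galTraceZ (K := K)) ?subvsP ?memvM ?kap_subr //.
  by rewrite dual_basP // eqxx mulr1.
rewrite fieldOver_scaleE -mulrA (galTraceZ (K := K)) ?subvsP ?memvM ?kap_subr //.
by rewrite dual_basP // (negPf (nlk : (l != k :> nat))) mulr0.
Qed.

(** The two sides have the same pairing with all elements of the basis, hence
    with the whole field.  So their difference [w] vanishes: otherwise all
    traces would be zero, as every element is a multiple of [w], whereas the
    basis and its dual provide an element of trace one. *)
Lemma dual_bas_expand z : z \in kap2 i j ->
  \sum_(k < size (bas D j i))
    (dual_bas D j i)`_k * vsval (edge_tr ((bas D j i)`_k * z)) = z.
Proof.
move=> Dz; set b := bas D j i; set d := dual_bas D j i.
have Dbk (l : 'I_(size b)) : b`_l \in kap2 i j by apply: bas_mem.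
have Ddk (l : 'I_(size b)) : d`_l \in kap2 i j by apply: dual_bas_memP.
have Dc (c : subvs_of (kap j)) : vsval c \in kap2 i j.
  by apply: (subvP (kap_subr i j)); apply: subvsP.
set z' := \sum_(_ < _) _.
have Dz' : z' \in kap2 i j by apply: memv_suml => k _; rewrite memvM.
pose w := z' - z; have Dw : w \in kap2 i j by rewrite memvB.
have tr_b (l : 'I_(size b)) : galTrace (kap j) (kap2 i j) (b`_l * w) = 0.
  rewrite mulrBr raddfB /= mulr_sumr raddf_sum /= (bigD1 l) //= big1 ?addr0 => [|k nkl].
    rewrite mulrA mulrC (galTraceZ (K := K)) ?subvsP ?memvM ?kap_subr //.
    by rewrite dual_basP // eqxx mulr1 val_edge_tr ?memvM // subrr.
  rewrite mulrA mulrC (galTraceZ (K := K)) ?subvsP ?memvM ?kap_subr //.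
  by rewrite dual_basP // eq_sym (negPf (nkl : (k != l :> nat))) mulr0.
have tr_w y : y \in kap2 i j -> galTrace (kap j) (kap2 i j) (y * w) = 0.
  move=> Dy; rewrite -(bas_expand Dy) mulr_suml raddf_sum big1 //= => k _.
  by rewrite -mulrA (galTraceZ (K := K)) ?subvsP ?memvM ?kap_subr // tr_b mulr0.
apply/eqP; rewrite -subr_eq0 -/w; apply/negP => /negP w0.
have lt0 : (0 < size b)%N.
  rewrite lt0n; apply/negP => /eqP b0; have := bas_expand (mem1v (kap2 i j)).
  rewrite -/b -/d big1 => [/eqP|k _]; first by rewrite eq_sym oner_eq0.
  by case: k => k ltk; exfalso; move: ltk; rewrite -/b b0.
have tr1 : galTrace (kap j) (kap2 i j) (b`_0 * d`_0) = 1 by rewrite dual_basP.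
suff /tr_w/eqP : b`_0 * d`_0 / w \in kap2 i j by rewrite divfK // tr1 oner_eq0.
have Db0 := Dbk (Ordinal lt0); have Dd0 := Ddk (Ordinal lt0).
by rewrite memvM ?memvV // memvM.
Qed.

Lemma ev_expand Y (t : edge i Y) :
  \sum_c \sum_(k < size (bas D j i))
    epure c (dual_bas D j i)`_k (ev c (bas D j i)`_k t) = t.
Proof.
apply: (tens_ev_expand (kap_subr j i) (kap_subl j i) edge_trD edge_trZ).
- by rewrite kap2C; apply: bas_mem.
- by rewrite kap2C; apply: dual_bas_memP.
- by move=> z; rewrite kap2C; apply: dual_bas_expand.
Qed.

Lemma ev_inj Y (t u : edge i Y) :
  (forall c y, y \in kap2 j i -> ev c y t = ev c y u) -> t = u.
Proof.
move=> tu; rewrite -[t]ev_expand -[u]ev_expand; apply: eq_bigr => c _.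
by apply: eq_bigr => k _; rewrite tu // kap2C bas_mem.
Qed.

Section Transpose.
Variables (X : vectType (subvs_of (kap i))) (Y : vectType (subvs_of (kap j))).

(** The map adjoint to [g]; for [g] a structure map of a module it is a
    component of the out-map. *)
Definition transpose (g : 'Hom(edge j X, Y)) (m : X) : edge i Y :=
  \sum_(a < narrows C i j) \sum_(k < size (bas D j i))
    epure (star D a) (dual_bas D j i)`_k (g (epure a (bas D j i)`_k m)).

(** The adjunction: [g] is recovered from its transpose by pairing with the
    trace form. *)
Lemma ev_transpose g a x m : x \in kap2 i j ->
  ev (star D a) x (transpose g m) = g (epure a x m).
Proof.
move=> Dx; rewrite ev_sum (bigD1 a) //= [X in _ + X]big1 ?addr0 => [|c nca].
  rewrite ev_sum; under eq_bigr => k _ do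
    rewrite ev_pure ?eqxx // 1?kap2C ?dual_bas_memP // -linearZ /=.
  rewrite -linear_sum /=; congr (g _).
  rewrite -[in RHS](bas_expand Dx) /epure.
  rewrite (tens_pure_suml (kap_subr i j) (kap_subl i j)) => [|k].
    by apply: eq_bigr => k _; rewrite -epureZ // bas_mem.
  rewrite memvM ?bas_mem //; apply: (subvP (kap_subr i j)); exact: subvsP.
rewrite ev_sum big1 // => k _; rewrite ev_pure 1?kap2C ?dual_bas_memP //.
by rewrite (inj_eq (can_inj (@starK _ _ _ _ D i j))) (negPf nca).
Qed.

(** The formula for the transpose is visibly additive; that it commutes with
    scalars of [kap i] is seen on the pairings, where the scalar moves through
    the tensor sign of the argument of [g]. *)
Lemma transpose_linear g : linear (transpose g).
Proof.
move=> e m m'; apply: ev_inj => c y Dy.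
rewrite -[c](starK D c) evD -evZr !ev_transpose // 1?kap2C //.
  by rewrite epureDr 1?kap2C // -epure_bal 1?kap2C // linearD.
by rewrite memvM //; apply: (subvP (kap_subr j i)); apply: subvsP.
Qed.

Lemma transpose_exists (h : 'Hom(X, edge i Y)) :
  exists g : 'Hom(edge j X, Y), forall m, transpose g m = h m.
Proof.
pose f a x (m : X) := ev (star D a) x (h m).
have [||||g [gE _]] := @tens_universal _ _ (kap j) (kap i) (kap2 i j)
    (narrows C i j) (kap_subr i j) (kap_subl i j) X Y f.
- by move=> a x y m _ _; apply: evDl.
- by move=> a x m m' _; rewrite /f linearD evD.
- by move=> a x c m Dx; rewrite /f linearZ evZr.
- by move=> a x c m Dx; rewrite /f evZl // kap2C.
exists g => m; apply: ev_inj => c y Dy.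
rewrite -[c](starK D c) ev_transpose 1?kap2C //.
by rewrite [LHS]gE 1?kap2C.
Qed.

End Transpose.
End Adjunction.

(** Naturality of the adjunction: a square with [g] and [g'] commutes if and
    only if the transposed square does. *)
Lemma transpose_nat i j (nij : i != j)
    (X X' : vectType (subvs_of (kap i))) (Y Y' : vectType (subvs_of (kap j)))
    (g : 'Hom(edge j X, Y)) (g' : 'Hom(edge j X', Y'))
    (f : 'Hom(X, X')) (h : 'Hom(Y, Y')) :
  (forall t, h (g t) = g' (edge_lfun j f t)) <->
  (forall m, edge_lfun i h (transpose g m) = transpose g' (f m)).
Proof.
split=> [hg m|hg].
  apply: (ev_inj nij) => c y Dy; rewrite -ev_nat // -[c](starK D c).
  by rewrite !(ev_transpose nij) 1?kap2C // hg edge_lfun_pure 1?kap2C.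
move=> t; rewrite -!comp_lfunE; move: t; apply: eq_edge_lfun => a x m Dx.
rewrite !comp_lfunE edge_lfun_pure // -!(ev_transpose nij) //.
by rewrite ev_nat 1?kap2C // hg.
Qed.

(** * Modules and their in-maps and out-maps *)

Local Notation mact := Defs.mact.
Local Notation hom := Defs.hom.
Local Notation path_module := (path_module D).
Local Notation module := (module D).

Definition out_comp (M : path_module) i j : 'Hom(M i, edge i (M j)) :=
  linfun (transpose (mact M j i)).
Definition in_comp (M : path_module) i j : 'Hom(edge i (M j), M i) :=
  (-1) ^+ sgn D i j *: mact M i j.

Lemma out_comp_transpose (M : path_module) i j m : i != j ->
  out_comp M i j m = transpose (mact M j i) m.
Proof. by move=> nij; apply: linear_linfunE; apply: transpose_linear. Qed.

Lemma out_compE (M : module) i j m : out_comp M i j m = out_map m j.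
Proof.
case: (eqVneq i j) => [<-|nij]; last exact: out_comp_transpose.
exact: edge_self_eq.
Qed.

Lemma in_mapE (M : module) i (t : around i M) : in_map t = \sum_j in_comp M i j (t j).
Proof.
rewrite (bigD1 i) //= (edge_self (t i)) linear0 add0r.
by apply: eq_bigr => j _; rewrite scale_lfunE.
Qed.

Lemma mact_out_comp (M : path_module) i j a x m : i != j -> x \in kap2 i j ->
  mact M j i (epure a x m) = ev (star D a) x (out_comp M i j m).
Proof. by move=> nij Dx; rewrite out_comp_transpose // ev_transpose. Qed.

Lemma mact_self (M : path_module) i t : mact M i i t = 0.
Proof. by rewrite (edge_self t) linear0. Qed.

Lemma in_out0 (M : module) i m : \sum_j in_comp M i j (out_comp M i j m) = 0.
Proof.
rewrite -[RHS](mrel m) (bigD1 i) //= [X in _ + X = _](_ : _ =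
    \sum_(j | j != i) in_comp M i j (transpose (mact M j i) m)); last first.
  by apply: eq_bigr => j nji; rewrite out_comp_transpose // eq_sym.
rewrite scale_lfunE mact_self scaler0 add0r; apply: eq_bigr => j _.
rewrite scale_lfunE linear_sum; congr (_ *: _); apply: eq_bigr => a _.
by rewrite linear_sum.
Qed.

Section OutHom.
Variables (M M' : path_module) (i j : 'I_n).
Variables (f : 'Hom(M i, M' i)) (h : 'Hom(M j, M' j)).

Lemma out_comp_hom : i != j ->
  (forall t, h (mact M j i t) = mact M' j i (edge_lfun j f t)) <->
  (forall m, edge_lfun i h (out_comp M i j m) = out_comp M' i j (f m)).
Proof.
move=> nij; rewrite transpose_nat //.
by split=> hg m; have := hg m; rewrite !out_comp_transpose.
Qed.

End OutHom.

Lemma eq_edge_map_lfun (M M' : path_module) i j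
    (f : 'Hom(M i, M' i)) (h : 'Hom(M j, M' j)) :
  (forall t, h (mact M j i t) = mact M' j i (edge_lfun j f t)) <->
  (forall a x m, x \in kap2 i j ->
     h (mact M j i (epure a x m)) = mact M' j i (epure a x (f m))).
Proof.
split=> hg => [a x m Dx|t]; first by rewrite hg edge_lfun_pure.
rewrite -!comp_lfunE; move: t; apply: eq_edge_lfun => a x m Dx.
by rewrite !comp_lfunE edge_lfun_pure // hg.
Qed.

Lemma hom_mact (M M' : module) (f : hom M M') i j t :
  f j (mact M j i t) = mact M' j i (edge_lfun j (f i) t).
Proof. by move: t; apply/eq_edge_map_lfun => a x m Dx; apply: homP. Qed.

Lemma hom_out_comp (M M' : module) (f : hom M M') i j m :
  edge_lfun i (f j) (out_comp M i j m) = out_comp M' i j (f i m).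
Proof.
case: (eqVneq i j) => [<-|nij]; first exact: edge_self_eq.
by move: m; apply: (proj1 (out_comp_hom (f i) (f j) nij)) => t; apply: hom_mact.
Qed.

Lemma mk_hom (M M' : module) (f : forall k, 'Hom(M k, M' k)) :
  (forall i j t, f j (mact M j i t) = mact M' j i (edge_lfun j (f i) t)) ->
  exists g : hom M M', forall k, g k = f k.
Proof.
move=> fh; have fP j i a x (m : M i) : x \in kap2 i j ->
    f j (mact M j i (epure a x m)) = mact M' j i (epure a x (f i m)).
  by move: a x m; apply/eq_edge_map_lfun.
by exists (Defs.Hom fP).
Qed.

Lemma submoduleP (M : module) (U : forall k, {vspace M k}) :
  is_submodule U <->
  (forall j i t, t \in edge_sub j (U i) -> mact M j i t \in U j).
Proof.
split=> subU j i; last first.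
  by move=> a x m Dx Um; apply/subU/mem_edge_sub_pure.
move=> t; elim/edge_sub_ind => [|u v Su Sv|a x m Dx Um].
- by rewrite linear0 mem0v.
- by rewrite linearD memvD.
- exact: subU.
Qed.

(** Stability under the maps leaving [i] can be tested on the out-map, again by
    the adjunction. *)
Lemma submodule_out (M : path_module) (U : forall k, {vspace M k}) i j : i != j ->
  (forall t, t \in edge_sub j (U i) -> mact M j i t \in U j) <->
  (forall m, m \in U i -> out_comp M i j m \in edge_sub i (U j)).
Proof.
move=> nij; split=> subU.
  move=> m Um; rewrite out_comp_transpose //; apply: memv_suml => a _.
  apply: memv_suml => k _; rewrite mem_edge_sub_pure 1?kap2C ?dual_bas_memP //.
  by apply: subU; rewrite mem_edge_sub_pure ?bas_mem.
move=> t; elim/edge_sub_ind => [|u v Su Sv|a x m Dx Um].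
- by rewrite linear0 mem0v.
- by rewrite linearD memvD.
rewrite mact_out_comp //; have /edge_subP <- := subU m Um.
by rewrite -ev_nat ?memv_proj // kap2C.
Qed.

Lemma row_dim0 (F : fieldType) m (y : 'rV[F]_m) : m = 0%N -> y = 0.
Proof. by move=> m0; subst m; apply/rowP; case. Qed.

Lemma row_dim1 (F : fieldType) m (y : 'rV[F]_m) :
  m = 1%N -> exists c, y = c *: const_mx 1.
Proof.
move=> m1; subst m; exists (y 0 0); apply/rowP => l.
by rewrite !mxE mulr1 !ord1.
Qed.

Lemma const_row_neq0 (F : fieldType) m : m = 1%N -> const_mx 1 != 0 :> 'rV[F]_m.
Proof.
move=> m1; subst m; apply/eqP => /rowP/(_ 0).
by rewrite !mxE; apply/eqP; rewrite oner_eq0.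
Qed.

(** * Simple submodules and quotients at a vertex *)

Definition out_inj i (M : module) :=
  forall m : M i, (forall j, out_comp M i j m = 0) -> m = 0.
Definition in_surj i (M : module) :=
  forall m : M i, exists t : around i M, \sum_j in_comp M i j (t j) = m.

Lemma mact_simple i j k t : mact (simple_module D i) j k t = 0.
Proof. exact: zero_lfunE. Qed.

Lemma simple_off i k (y : simple_module D i k) : k != i -> y = 0.
Proof. by move=> nki; apply: row_dim0; rewrite (negPf nki). Qed.

Lemma simple_self i (y : simple_module D i i) : exists c, y = c *: const_mx 1.
Proof. by apply: row_dim1; rewrite eqxx. Qed.

Lemma simple_one_neq0 i : const_mx 1 != 0 :> simple_module D i i.
Proof. by apply: const_row_neq0; rewrite eqxx. Qed.

Lemma simple_functional i (V : vectType (subvs_of (kap i))) (U : {vspace V}) m :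
  m \notin U -> exists2 f : 'Hom(V, simple_module D i i),
    f m != 0 & forall u, u \in U -> f u = 0.
Proof.
move=> Um; pose w := m - projv U m.
have w0 : w != 0 by apply: contraNneq Um => /subr0_eq ->; apply: memv_proj.
have [l cl] : exists l, coord (vbasis fullv) l w != 0.
  apply/existsP; rewrite -negb_forall; apply: contra w0 => /forallP c0.
  rewrite (coord_vbasis (memvf w)) big1 // => l _.
  by have := c0 l; case: eqP => // ->; rewrite scale0r.
have lin : linear (fun v : V =>
    coord (vbasis fullv) l (v - projv U v) *: (const_mx 1 : simple_module D i i)).
  move=> c u v; rewrite scalerA -scalerDl; congr (_ *: _).
  by rewrite linearP /= opprD addrACA -scalerBr linearP.
have [f fE] := linfun_exists lin; exists f; last first.
  by move=> u Uu; rewrite fE projv_id // subrr linear0 scale0r.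
by rewrite fE scaler_eq0 negb_or cl simple_one_neq0.
Qed.

Lemma simple_vector i (V : vectType (subvs_of (kap i))) (m : V) :
  exists f : 'Hom(simple_module D i i, V), forall c, f (c *: const_mx 1) = c *: m.
Proof.
have lin : linear (fun v : simple_module D i i => (\sum_l v 0 l) *: m).
  move=> c u v; rewrite scalerA -scalerDl; congr (_ *: _).
  by rewrite mulr_sumr -big_split; apply: eq_bigr => l _; rewrite !mxE.
have [f fE] := linfun_exists lin; exists f => c; rewrite fE; congr (_ *: _).
under eq_bigr do rewrite !mxE mulr1.
by rewrite sumr_const card_ord eqxx mulr1n.
Qed.

(** A map concentrated at [i] which kills the images of the maps into [i] and
    whose image is killed by the maps out of [i] is a morphism. *)
Lemma hom_at i (M M' : module) (g : 'Hom(M i, M' i)) :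
  (forall j t, g (mact M i j t) = 0) ->
  (forall j m, out_comp M' i j (g m) = 0) ->
  exists2 f : hom M M', f i = g & forall k, k != i -> f k = 0.
Proof.
move=> g_in g_out.
pose f k := @dfwith 'I_n (fun k => 'Hom(M k, M' k)) (fun=> 0) i g k.
have fi : f i = g by rewrite /f dfwith_in.
have f0 k : k != i -> f k = 0 by move=> nki; rewrite /f dfwith_out // eq_sym.
have [|h hE] := @mk_hom M M' f; last first.
  by exists h => [|k nki]; rewrite hE ?fi ?f0.
move=> k j t; case: (eqVneq k j) t => [<-|nkj] t.
  by rewrite !mact_self linear0.
case: (eqVneq j i) nkj t => [->|nji] nkj t.
  by rewrite fi g_in f0 // edge_lfun0 linear0.
rewrite f0 // zero_lfunE; case: (eqVneq k i) nkj t => [->|nki] nkj t.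
  have g0 : forall u, (0 : 'Hom(M j, M' j)) (mact M j i u)
      = mact M' j i (edge_lfun j g u).
    by apply: (proj2 (out_comp_hom g 0 nkj)) => m; rewrite edge_lfun0 g_out.
  by rewrite fi -g0 zero_lfunE.
by rewrite f0 // edge_lfun0 linear0.
Qed.

(** A vector killed by the out-map is killed by all maps leaving [i], so it
    spans a copy of the simple module. *)
Lemma no_subP i (M : module) : no_sub i M <-> out_inj i M.
Proof.
split=> [nosub m out0|oinj [f finj]].
  apply/eqP; apply: contraT => m0; case: nosub.
  have [g gE] := simple_vector m.
  have [||f fi f0] := @hom_at i (simple_module D i) M g.
  - by move=> j t; rewrite mact_simple linear0.
  - move=> j y; have [c ->] := simple_self y.
    by rewrite gE linearZ /= out0 scaler0.
  exists f => k; case: (eqVneq k i) => [->|nki] x y; last first.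
    by move=> _; rewrite (simple_off x nki) (simple_off y nki).
  have [c ->] := simple_self x; have [d ->] := simple_self y.
  rewrite fi !gE => /eqP; rewrite -subr_eq0 -scalerBl scaler_eq0 (negPf m0) orbF.
  by rewrite subr_eq0 => /eqP ->.
have m0 : f i (const_mx 1) = 0.
  apply: oinj => j; rewrite -hom_out_comp; case: (eqVneq i j) => [<-|nij].
    exact: edge_self.
  have -> : out_comp (simple_module D i) i j (const_mx 1) = 0; last exact: linear0.
  rewrite out_comp_transpose // /transpose big1 // => a _; apply: big1 => k _.
  by rewrite mact_simple epure0r // 1?kap2C dual_bas_memP.
by have := simple_one_neq0 i; rewrite -(inj_eq (finj i)) linear0 m0 eqxx.
Qed.

(** Dually, a linear form on [M i] vanishing on the image of the in-map is a
    morphism to the simple module. *)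
Lemma no_quotP i (M : module) : no_quot i M <-> in_surj i M.
Proof.
split=> [noquot m|isurj [f fsurj]]; last first.
  have [m fm] := fsurj i (const_mx 1).
  have [t tm] := isurj m.
  have := simple_one_neq0 i; rewrite -fm -tm linear_sum big1 ?eqxx //= => j _.
  by rewrite scale_lfunE linearZ /= (hom_mact f) mact_simple scaler0.
pose I := (\sum_j limg (in_comp M i j))%VS.
have inI j t : mact M i j t \in I.
  apply: (subvP (sumv_sup j isT (subvv _))).
  have -> : mact M i j t = in_comp M i j ((-1) ^+ sgn D i j *: t).
    by rewrite linearZ /= scale_lfunE scalerA -expr2 sqrr_sign scale1r.
  by rewrite memv_img ?memvf.
case: (boolP (m \in I)) => [/memv_sumP[ms msP ->]|Im].
  have /fin_all_exists[t tP] j : exists t, in_comp M i j t = ms j.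
    by have /memv_imgP[t _ ->] := msP j isT; exists t.
  by exists t; apply: eq_bigr => j _; rewrite tP.
case: noquot; have [g gm gI] := simple_functional Im.
have [||f fi f0] := @hom_at i M (simple_module D i) g.
- by move=> j t; rewrite gI.
- move=> j y; case: (eqVneq i j) => [<-|nij]; first exact: edge_self.
  rewrite out_comp_transpose // /transpose big1 // => a _; apply: big1 => k _.
  by rewrite mact_simple epure0r // 1?kap2C dual_bas_memP.
exists f => k y; case: (eqVneq k i) y => [->|nki] y; last first.
  by exists 0; rewrite [RHS]simple_off // linear0.
have [c ->] := simple_self y; have [d dE] := simple_self (g m).
have d0 : d != 0 by apply: contraNneq gm => d0; rewrite dE d0 scale0r.
by exists ((c / d) *: m); rewrite fi linearZ /= dE scalerA divfK.
Qed.

(** * Reflection pairs *)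

Section ReflectionPair.
Variables (i : 'I_n) (M N : module) (phi : forall k, 'Hom(N k, M k)).

Definition out_phi j : 'Hom(N i, edge i (M j)) :=
  (edge_lfun i (phi j) \o out_comp N i j)%VF.

(** The relation between [M] and [N] = Sigma_i [M], up to isomorphism: [phi]
    identifies the two modules away from [i], and through it the out-map of
    [N] becomes a kernel of the in-map of [M]. *)
Record refl_pair : Prop := ReflPair {
  rp_bij : forall k, k != i -> bijective (phi k);
  rp_off : forall j k, j != i -> k != i -> forall t,
    phi j (mact N j k t) = mact M j k (edge_lfun j (phi k) t);
  rp_inj : out_inj i N;
  rp_surj : in_surj i M;
  rp_exact : forall t : around i M,
    \sum_j in_comp M i j (t j) = 0 <-> exists m, forall j, out_phi j m = t j;
  rp_comm : forall j k t,
    out_phi k (mact N i j t) = out_comp M i k (mact M i j (edge_lfun i (phi j) t))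
}.

Hypothesis MN : refl_pair.

Lemma rp_edge_bij j : bijective (edge_lfun i (phi j)).
Proof.
case: (eqVneq j i) => [->|nji]; last exact: edge_lfun_bij (rp_bij MN nji).
by exists (fun=> 0) => t; apply: edge_self_eq.
Qed.

Lemma rp_out_phi_inj m : (forall j, out_phi j m = 0) -> m = 0.
Proof.
move=> m0; apply: (rp_inj MN) => j; apply: (bij_inj (rp_edge_bij j)).
by rewrite linear0 -[LHS]comp_lfunE m0.
Qed.

Section Dimension.
Variable U : forall k, {vspace M k}.

(** Given components [U k] away from [i], a submodule of [M] has at [i] at least
    [in_span], and a submodule of [N] with the corresponding components at most
    [out_preim]. *)
Definition in_span : {vspace M i} := (\sum_j in_comp M i j @: edge_sub i (U j))%VS.
Definition out_preim : {vspace N i} :=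
  (\bigcap_j (out_phi j @^-1: edge_sub i (U j)))%VS.

Lemma rp_dim : (\dim out_preim + \dim in_span =
  \sum_(j | j != i) absz (cartan C i j) * \dim (U j))%N.
Proof.
rewrite addnC /out_preim /in_span.
have -> := exact_dim (fun j => edge_sub i (U j)) rp_out_phi_inj (rp_exact MN).
rewrite (bigD1 i) //=; have -> : edge_sub i (U i) = 0%VS.
  exact: edge_self_vspace.
by rewrite dimv0 add0n; apply: eq_bigr => j nji; rewrite dim_edge_sub // eq_sym.
Qed.

End Dimension.

Variable R : realType.

Lemma rp_dimvec (U : forall k, {vspace M k}) (W : forall k, {vspace N k}) :
  (forall k, k != i -> \dim (W k) = \dim (U k)) ->
  W i = out_preim U -> U i = in_span U ->
  dimvec R W = refl C i (dimvec R U).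
Proof.
move=> dimWU Wi Ui; apply: refl_of_coords => [k nki|].
  by rewrite !mxE dimWU.
rewrite !mxE Wi [in LHS]Ui -natrD rp_dim natr_sum; apply: eq_bigr => j nji.
by rewrite natrM mxE.
Qed.

Lemma bij_dim_eq (F : fieldType) (V W : vectType F) (f : 'Hom(V, W)) :
  bijective f -> \dim {:V} = \dim {:W}.
Proof.
by move=> fb; have [_ <-] := proj1 (lfun_bij f) fb; rewrite dim_limg_inj //; apply: bij_inj.
Qed.

Lemma out_preimP (U : forall k, {vspace M k}) m :
  reflect (forall j, out_phi j m \in edge_sub i (U j)) (m \in out_preim U).
Proof. exact: memv_bigcap_preim. Qed.

Lemma mem_in_span (U : forall k, {vspace M k}) j t :
  t \in edge_sub i (U j) -> mact M i j t \in in_span U.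
Proof.
move=> Ut; apply: (subvP (sumv_sup j isT (subvv _))).
have -> : mact M i j t = in_comp M i j ((-1) ^+ sgn D i j *: t).
  by rewrite linearZ /= scale_lfunE scalerA -expr2 sqrr_sign scale1r.
by rewrite memv_img // memvZ.
Qed.

Lemma in_span_sub (U : forall k, {vspace M k}) (A : {vspace M i}) :
  (forall j t, t \in edge_sub i (U j) -> mact M i j t \in A) ->
  (in_span U <= A)%VS.
Proof.
move=> UA; apply/subv_sumP => j _; apply/subvP => _ /memv_imgP[t Ut ->].
by rewrite scale_lfunE memvZ // UA.
Qed.

Lemma in_span_eq (U U' : forall k, {vspace M k}) :
  (forall k, k != i -> U k = U' k) -> in_span U = in_span U'.
Proof.
move=> UU'; rewrite /in_span; apply: eq_bigr => j _.
suff -> : edge_sub i (U j) = edge_sub i (U' j) by [].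
by case: (eqVneq j i) => [->|nji]; [apply: edge_self_vspace | rewrite UU'].
Qed.

Lemma out_preim_eq (U U' : forall k, {vspace M k}) :
  (forall k, k != i -> U k = U' k) -> out_preim U = out_preim U'.
Proof.
move=> UU'; rewrite /out_preim; apply: eq_bigr => j _.
suff -> : edge_sub i (U j) = edge_sub i (U' j) by [].
by case: (eqVneq j i) => [->|nji]; [apply: edge_self_vspace | rewrite UU'].
Qed.

Lemma rp_mdim : mdim R N = refl C i (mdim R M).
Proof.
apply: rp_dimvec => [k nki||]; first exact: bij_dim_eq (rp_bij MN nki).
  apply/vspaceP => m; rewrite memvf; apply/esym/out_preimP => j.
  by rewrite edge_sub_full memvf.
apply/vspaceP => m; rewrite memvf; have [t <-] := rp_surj MN m.
by apply/esym/memv_sumr => j _; rewrite memv_img // edge_sub_full memvf.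
Qed.

Lemma dimvec_dfwith (P : module) (U : forall k, {vspace P k}) (A : {vspace P i}) :
  dimvec R U = dimvec R (dfwith (T := fun k => {vspace P k}) U A)
             + ((\dim (U i))%:R - (\dim A)%:R) *: alpha R i.
Proof.
apply/rowP => k; rewrite !mxE eqxx /=; case: (eqVneq k i) => [->|nki].
  by rewrite dfwith_in mulr1 addrC subrK.
by rewrite dfwith_out 1?eq_sym // mulr0 addr0.
Qed.

Lemma preim_bij_img (F : fieldType) (V W : vectType F) (f : 'Hom(V, W))
    (U : {vspace W}) : bijective f -> (f @: (f @^-1: U))%VS = U.
Proof. by move=> /lfun_bij[_ fW]; rewrite lpreimK // fW subvf. Qed.

(** From a submodule of [N] to the smallest submodule of [M] with the same
    components away from [i]. *)
Lemma rp_image_submodule (U : forall k, {vspace N k})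
    (V := fun k => (phi k @: U k)%VS) :
  is_submodule U ->
  is_submodule (dfwith (T := fun k => {vspace M k}) V (in_span V)) /\
  (U i <= out_preim V)%VS.
Proof.
move=> /submoduleP subU.
have out_U m j : m \in U i -> out_phi j m \in edge_sub i (V j).
  move=> Um; rewrite comp_lfunE; apply: mem_edge_sub_img.
  case: (eqVneq i j) => [<-|nij]; first by rewrite (edge_self (out_comp _ _ _ _)) mem0v.
  by move: m Um; apply/submodule_out => // t; apply: subU.
split; last by apply/subvP => m Um; apply/out_preimP => j; apply: out_U.
apply/submoduleP => j k t.
case: (eqVneq j i) t => [->|nji] t.
  rewrite dfwith_in; case: (eqVneq k i) t => [->|nki] t.
    by rewrite mact_self mem0v.
  by rewrite dfwith_out 1?eq_sym //; apply: mem_in_span.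
rewrite [dfwith _ _ j]dfwith_out 1?eq_sym //.
case: (eqVneq k i) t => [->|nki] t; last first.
  rewrite dfwith_out 1?eq_sym // edge_sub_img => /memv_imgP[u Uu ->].
  by rewrite -(rp_off MN) // memv_img // subU.
rewrite dfwith_in; set W := in_span V; move: t.
pose V' k := @dfwith 'I_n (fun k => {vspace M k}) V i W k.
have V'i : V' i = W by rewrite /V' dfwith_in.
have V'j : V' j = V j by rewrite /V' dfwith_out // eq_sym.
rewrite -V'i -V'j; apply/submodule_out; first by rewrite eq_sym.
rewrite V'i V'j => m Wm; rewrite memv_preim; apply: (subvP _ _ Wm).
apply: in_span_sub => l t; rewrite -memv_preim edge_sub_img => /memv_imgP[u Uu ->].
by rewrite -(rp_comm MN) out_U // subU.
Qed.

(** From a submodule of [M] to the largest submodule of [N] with the same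
    components away from [i]. *)
Lemma rp_preim_submodule (U : forall k, {vspace M k})
    (V := fun k => (phi k @^-1: U k)%VS) :
  is_submodule U ->
  is_submodule (dfwith (T := fun k => {vspace N k}) V (out_preim U)) /\
  (in_span U <= U i)%VS.
Proof.
move=> /submoduleP subU; split; last by apply: in_span_sub => j t; apply: subU.
have phiV j k t : t \in edge_sub j (V k) -> edge_lfun j (phi k) t \in edge_sub j (U k).
  elim/edge_sub_ind => [|u v Su Sv|a x u Dx Vu].
  - by rewrite linear0 mem0v.
  - by rewrite linearD memvD.
  - by rewrite edge_lfun_pure // mem_edge_sub_pure // memv_preim.
apply/submoduleP => j k t.
case: (eqVneq j i) t => [->|nji] t.
  rewrite dfwith_in; case: (eqVneq k i) t => [->|nki] t.
    by rewrite mact_self mem0v.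
  rewrite dfwith_out 1?eq_sym // => Vt; apply/out_preimP => l.
  rewrite (rp_comm MN); case: (eqVneq i l) => [<-|nil].
    by rewrite (edge_self (out_comp _ _ _ _)) mem0v.
  have Um : mact M i k (edge_lfun i (phi k) t) \in U i by apply/subU/phiV.
  by move: (mact M i k _) Um; apply/submodule_out => // u; apply: subU.
rewrite [dfwith _ _ j]dfwith_out 1?eq_sym //.
case: (eqVneq k i) t => [->|nki] t; last first.
  rewrite dfwith_out 1?eq_sym // => Vt.
  by rewrite -memv_preim (rp_off MN) //; apply/subU/phiV.
rewrite dfwith_in; set W := out_preim U; move: t.
pose V' k := @dfwith 'I_n (fun k => {vspace N k}) V i W k.
have V'i : V' i = W by rewrite /V' dfwith_in.
have V'j : V' j = V j by rewrite /V' dfwith_out // eq_sym.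
rewrite -V'i -V'j; apply/submodule_out; first by rewrite eq_sym.
rewrite V'i V'j => m /out_preimP/(_ j); rewrite comp_lfunE.
rewrite -[U j](preim_bij_img _ (rp_bij MN nji)) edge_sub_img => /memv_imgP[u Vu].
by move/(bij_inj (rp_edge_bij j)) ->.
Qed.

(** The sign of [theta (alpha R i)] makes it enough to test submodules of [N]
    with the largest, and submodules of [M] with the smallest component at
    [i]; these are exchanged by [rp_image_submodule] and [rp_preim_submodule],
    and their dimension vectors by the reflection. *)
Lemma rp_semistable (theta : 'Hom('rV[R]_n, R^o)) : theta (alpha R i) <= 0 ->
  semistable theta N <-> semistable (dual_refl C i theta) M.
Proof.
move=> theta_i; rewrite /semistable dual_reflD -rp_mdim.
split=> -[-> stab]; split=> // U subU.
  have [/stab + /dimvS le_dim] := rp_preim_submodule subU.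
  rewrite (dimvec_dfwith U (in_span U)) linearD /= dual_reflD.
  rewrite -(rp_dimvec (W := dfwith (T := fun k => {vspace N k})
      (fun k => phi k @^-1: U k)%VS (out_preim U))); first last.
  - by rewrite dfwith_in; apply: in_span_eq => k nki; rewrite dfwith_out 1?eq_sym.
  - by rewrite dfwith_in; apply: out_preim_eq => k nki; rewrite dfwith_out 1?eq_sym.
  - move=> k nki; rewrite !dfwith_out 1?eq_sym //.
    rewrite -[in RHS](preim_bij_img (U k) (rp_bij MN nki)) dim_limg_inj //.
    exact: bij_inj (rp_bij MN nki).
  move=> ge0; rewrite addr_ge0 // linearZ /= dual_refl_alpha mulr_ge0 ?oppr_ge0 //.
  by rewrite subr_ge0 ler_nat.
have [/stab + /dimvS le_dim] := rp_image_submodule subU.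
set V := fun k => (phi k @: U k)%VS; rewrite dual_reflD.
rewrite -(rp_dimvec (W := dfwith (T := fun k => {vspace N k}) U (out_preim V))); first last.
- by rewrite dfwith_in; apply: in_span_eq => k nki; rewrite dfwith_out 1?eq_sym.
- by rewrite dfwith_in; apply: out_preim_eq => k nki; rewrite dfwith_out 1?eq_sym.
- move=> k nki; rewrite !dfwith_out 1?eq_sym // dim_limg_inj //.
  exact: bij_inj (rp_bij MN nki).
rewrite (dimvec_dfwith U (out_preim V)) linearD /=.
move=> ge0; rewrite addr_ge0 // linearZ /= mulr_le0 //.
by rewrite subr_le0 ler_nat.
Qed.

End ReflectionPair.

(** * Bricks *)

Lemma mact_in_comp (M M' : path_module) i j (h : 'Hom(M i, M' i))
    (f : 'Hom(M j, M' j)) t :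
  h (in_comp M i j t) = in_comp M' i j (edge_lfun i f t) <->
  h (mact M i j t) = mact M' i j (edge_lfun i f t).
Proof.
rewrite !scale_lfunE linearZ /=; split=> [|-> //].
by move/(can_inj (signrZK _)).
Qed.

(** An injective endomorphism of a finite dimensional module is invertible. *)
Lemma brickP (M : module) :
  brick M <-> (exists i (m : M i), m != 0) /\
    forall f : hom M M, (exists i, f i != 0) -> forall k, injective (f k).
Proof.
split=> -[M0 br]; split=> // f f0.
  by move=> k; have [g gK] := br f f0; apply: can_inj (proj1 (gK k)).
have fb k : bijective (f k) by apply/inj_lfun_bij/br.
have [|g gE] := @mk_hom M M (fun k => (f k)^-1%VF).
  move=> k j t; apply: (bij_inj (fb j)).
  rewrite bij_lfunVK; last exact: fb.
  by rewrite (hom_mact f (edge_lfun j (f k)^-1%VF t)) edge_lfunV.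
by exists g => k; rewrite gE; split; [apply: bij_lfunK (fb k) | apply: bij_lfunVK (fb k)].
Qed.

Section BrickTransfer.
Variables (i : 'I_n) (M N : module) (phi : forall k, 'Hom(N k, M k)).
Hypothesis MN : refl_pair i phi.

Lemma edge_commute j (f : 'End(N j)) (g : 'End(M j)) :
  (j != i -> forall x, g (phi j x) = phi j (f x)) ->
  forall t, edge_lfun i g (edge_lfun i (phi j) t)
          = edge_lfun i (phi j) (edge_lfun i f t).
Proof.
case: (eqVneq j i) f g => [->|nji] f g fg t; first exact: edge_self_eq.
rewrite -!edge_lfun_comp; congr (edge_lfun i _ t); apply/lfunP => x.
by rewrite !comp_lfunE fg.
Qed.

(** The component at [i] is induced on the cokernel [M i] of the out-map of
    [N].  Compatibility with the maps leaving [i] is checked on out-maps, where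
    it follows from [rp_comm]. *)
Lemma hom_push (f : hom N N) :
  exists g : hom M M, forall k, k != i -> forall x, g k (phi k x) = phi k (f k x).
Proof.
pose F k : 'End(M k) := (phi k \o f k \o (phi k)^-1)%VF.
have Fphi k : k != i -> forall x, F k (phi k x) = phi k (f k x).
  by move=> nki x; rewrite !comp_lfunE bij_lfunK //; apply: rp_bij MN _ nki.
have eF k t := edge_commute (Fphi k) t.
have [||h hE] := @coker_factor _ _ _ (M i) (M i) (in_comp M i)
    (fun j => in_comp M i j \o edge_lfun i (F j))%VF.
- exact: rp_surj MN.
- move=> t /(rp_exact MN)[m tE]; under eq_bigr do rewrite comp_lfunE.
  apply/(rp_exact MN); exists (f i m) => j.
  by rewrite -tE !comp_lfunE eF (hom_out_comp f).
have {}hE j t : h (mact M i j t) = mact M i j (edge_lfun i (F j) t).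
  by apply/mact_in_comp; rewrite hE comp_lfunE.
pose G k := @dfwith 'I_n (fun k => 'End(M k)) F i h k.
have Gi : G i = h by rewrite /G dfwith_in.
have GF k : k != i -> G k = F k by move=> nki; rewrite /G dfwith_out // eq_sym.
have [|g gE] := @mk_hom M M G; last by exists g => k nki x; rewrite gE GF ?Fphi.
move=> k j t; case: (eqVneq j i) t => [->|nji] t.
  case: (eqVneq k i) t => [->|nki] t; first by rewrite !mact_self linear0.
  by rewrite Gi hE GF.
rewrite (GF j) //; case: (eqVneq k i) t => [->|nki] t; last first.
  rewrite GF // -[t](edge_lfunV _ (rp_bij MN nki)) -(rp_off MN) // Fphi //.
  rewrite (hom_mact f) (rp_off MN) // -!edge_lfun_comp.
  congr (mact M j k (edge_lfun j _ _)).
  by apply/lfunP => x; rewrite !comp_lfunE (bij_lfunK (rp_bij MN nki)).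
rewrite Gi; move: t; apply/out_comp_hom => [|m]; first by rewrite eq_sym.
have [t <-] := rp_surj MN m; rewrite !linear_sum /=; apply: eq_bigr => l _.
rewrite !scale_lfunE !linearZ /=; congr (_ *: _).
have [u <-] : exists u, edge_lfun i (phi l) u = t l.
  by have [e _ eK] := rp_edge_bij MN l; exists (e (t l)).
rewrite hE eF -!(rp_comm MN) -(hom_mact f) /out_phi !comp_lfunE -(hom_out_comp f).
by rewrite eF.
Qed.

(** Here the component at [i] is the restriction to the kernel [N i] of the
    in-map of [M]. *)
Lemma hom_pull (g : hom M M) :
  exists f : hom N N, forall k, k != i -> forall x, g k (phi k x) = phi k (f k x).
Proof.
pose F k : 'End(N k) := ((phi k)^-1 \o g k \o phi k)%VF.
have Fphi k : k != i -> forall x, g k (phi k x) = phi k (F k x).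
  by move=> nki x; rewrite !comp_lfunE bij_lfunVK //; apply: rp_bij MN _ nki.
have eF k t := edge_commute (Fphi k) t.
have [||h hE] := @ker_factor _ _ _ (N i) (N i) (out_phi i phi)
    (fun j => edge_lfun i (g j) \o out_phi i phi j)%VF.
- exact: rp_out_phi_inj MN.
- move=> m; apply/(rp_exact MN).
  have /(congr1 (g i)) : \sum_j in_comp M i j (out_phi i phi j m) = 0.
    by apply/(rp_exact MN); exists m.
  rewrite linear0 linear_sum /= => E; rewrite -[RHS]E; apply: eq_bigr => j _.
  by rewrite comp_lfunE; apply/esym/mact_in_comp/hom_mact.
have {}hE m j : out_phi i phi j (h m) = edge_lfun i (g j) (out_phi i phi j m).
  by rewrite hE comp_lfunE.
pose G k := @dfwith 'I_n (fun k => 'End(N k)) F i h k.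
have Gi : G i = h by rewrite /G dfwith_in.
have GF k : k != i -> G k = F k by move=> nki; rewrite /G dfwith_out // eq_sym.
have [|f fE] := @mk_hom N N G; last by exists f => k nki x; rewrite fE GF ?Fphi.
move=> k j t; case: (eqVneq j i) t => [->|nji] t.
  case: (eqVneq k i) t => [->|nki] t; first by rewrite !mact_self linear0.
  rewrite Gi GF //; apply/eqP; rewrite -subr_eq0; apply/eqP/(rp_out_phi_inj MN) => l.
  rewrite linearB /= hE !(rp_comm MN) -eF -(hom_mact g) -(hom_out_comp g).
  exact: subrr.
rewrite (GF j) //; case: (eqVneq k i) t => [->|nki] t; last first.
  apply: (bij_inj (rp_bij MN nji)); rewrite -Fphi // !(rp_off MN) // (hom_mact g) GF //.
  rewrite -!edge_lfun_comp; congr (mact M j k (edge_lfun j _ _)).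
  by apply/lfunP => x; rewrite [LHS]comp_lfunE [RHS]comp_lfunE Fphi.
rewrite Gi; move: t; apply/out_comp_hom => [|m]; first by rewrite eq_sym.
apply: (bij_inj (rp_edge_bij MN j)); rewrite -eF.
by have := hE m j; rewrite /out_phi !comp_lfunE.
Qed.

(** A nonzero endomorphism [f] of [N] induces one of [M], which is injective.
    So [f] is injective away from [i], and then also at [i], where [N i]
    embeds into the neighbouring spaces. *)
Lemma rp_brick_push : (exists k (m : N k), m != 0) -> brick M -> brick N.
Proof.
move=> N0 /brickP[_ brM]; apply/brickP; split=> // f f0.
have [g gf] := hom_push f.
have /brM ginj : exists k, g k != 0.
  apply/existsP; rewrite -negb_forall; apply/negP => /forallP g0.
  have {}g0 k : g k = 0 by have := g0 k; case: eqP.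
  have fk k : k != i -> f k = 0.
    move=> nki; apply/lfunP => x; apply: (bij_inj (rp_bij MN nki)).
    by rewrite -gf // g0 !zero_lfunE linear0.
  have [k] := f0; case: (eqVneq k i) => [->|/fk->]; last by rewrite eqxx.
  case/eqP; apply/lfunP => m; rewrite zero_lfunE; apply: (rp_inj MN) => j.
  rewrite -(hom_out_comp f); case: (eqVneq j i) => [->|nji]; first exact: edge_self.
  by rewrite fk // edge_lfun0.
have finj k : k != i -> injective (f k).
  move=> nki x y xy; apply: (bij_inj (rp_bij MN nki)); apply: (ginj k).
  by rewrite !gf // xy.
move=> k; case: (eqVneq k i) => [->|/finj //].
apply/lker0P; apply/eqP/vspaceP => m; rewrite memv0 memv_ker.
apply/eqP/eqP => [fm|->]; last by rewrite linear0.
apply: (rp_inj MN) => j; case: (eqVneq j i) => [->|/finj fj]; first exact: edge_self.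
by apply: (edge_lfun_inj fj); rewrite (hom_out_comp f) fm !linear0.
Qed.

(** As for [rp_brick_push], with surjectivity of the in-map of [M] in place of
    injectivity of the out-map of [N]. *)
Lemma rp_brick_pull : (exists k (m : M k), m != 0) -> brick N -> brick M.
Proof.
move=> M0 /brickP[_ brN]; apply/brickP; split=> // g g0.
have [f fg] := hom_pull g.
have gi j t : g i (mact M i j t) = mact M i j (edge_lfun i (g j) t) by apply: hom_mact.
have /brN finj : exists k, f k != 0.
  apply/existsP; rewrite -negb_forall; apply/negP => /forallP f0.
  have {}f0 k : f k = 0 by have := f0 k; case: eqP.
  have gk k : k != i -> g k = 0.
    move=> nki; apply/lfunP => x; rewrite -[x](bij_lfunVK (rp_bij MN nki)).
    by rewrite fg // f0 !zero_lfunE linear0.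
  have [k] := g0; case: (eqVneq k i) => [->|/gk->]; last by rewrite eqxx.
  case/eqP; apply/lfunP => m; rewrite zero_lfunE; have [t <-] := rp_surj MN m.
  rewrite linear_sum big1 //= => j _; rewrite scale_lfunE linearZ /= gi.
  case: (eqVneq j i) => [->|nji]; first by rewrite mact_self scaler0.
  by rewrite gk // edge_lfun0 linear0 scaler0.
have gbij k : k != i -> bijective (g k).
  move=> nki; apply: inj_lfun_bij => x y; have phik := rp_bij MN nki.
  rewrite -[x](bij_lfunVK phik) -[y](bij_lfunVK phik) fg // fg //.
  by move/(bij_inj phik)/(finj k) ->.
move=> k; case: (eqVneq k i) => [->|/gbij/bij_inj //].
apply: surj_lfun_inj; apply/lfun_surj => m; have [t <-] := rp_surj MN m.
have /fin_all_exists[u uE] j : exists u, edge_lfun i (g j) u = t j.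
  case: (eqVneq j i) => [->|nji]; first by exists 0; apply: edge_self_eq.
  by have [e _ eK] := edge_lfun_bij i (gbij j nji); exists (e (t j)).
exists (\sum_j in_comp M i j (u j)); rewrite linear_sum; apply: eq_bigr => j _.
by rewrite !scale_lfunE linearZ /= gi uE.
Qed.

End BrickTransfer.

(** * Construction of modules by surgery at a vertex *)

Lemma relationP (P : path_module) :
  preproj_relations P <->
  forall i (m : P i), \sum_(j | j != i)
    (-1) ^+ sgn D i j *: mact P i j (transpose (mact P j i) m) = 0.
Proof.
have relE i (m : P i) j : mact P i j (transpose (mact P j i) m) =
    \sum_(a < narrows C i j) \sum_(k < size (bas D j i))
      mact P i j (epure (star D a) (dual_bas D j i)`_k
        (mact P j i (epure a (bas D j i)`_k m))).
  by rewrite linear_sum; apply: eq_bigr => a _; rewrite linear_sum.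
split=> rel i m; rewrite -[RHS](rel i m); apply: eq_bigr => j _.
  by rewrite relE.
by rewrite relE.
Qed.

Lemma edge_bijK i j (U V : vectType (subvs_of (kap j))) (f : 'Hom(U, V)) :
  (j != i -> bijective f) ->
  cancel (edge_lfun i f) (edge_lfun i f^-1%VF) /\
  cancel (edge_lfun i f^-1%VF) (edge_lfun i f).
Proof.
case: (eqVneq j i) U V f => [->|nji] U V f fb.
  by split=> t; apply: edge_self_eq.
have {}fb := fb isT; split=> t; last exact: edge_lfunV.
rewrite -edge_lfun_comp -[RHS]edge_lfun1; congr (edge_lfun i _ t).
by apply/lfunP => x; rewrite comp_lfunE id_lfunE bij_lfunK.
Qed.

(** Replacing the space of a module at [i] by [Y], with in-map [e] and out-map
    [h].  The relation at [i] is [eh0].  The relation at another vertex [v]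
    involves [i] only through the paths from [v] to [i] and back, which are
    unchanged because [h] composed with [e] is the old composite.  All spaces
    are given up to isomorphism, as the type family of the new module is
    defined by cases. *)
Section Surgery.
Variables (i : 'I_n) (M : module) (Y : vectType (subvs_of (kap i))).
Variables (e : forall j, 'Hom(edge i (M j), Y)) (h : forall j, 'Hom(Y, edge i (M j))).
Hypothesis eh0 : forall y, \sum_(j | j != i) (-1) ^+ sgn D i j *: e j (h j y) = 0.
Hypothesis he : forall j k t, h k (e j t) = out_comp M i k (mact M i j t).

Lemma surgery : exists (N : module) (psi : forall k, 'Hom(M k, N k)) (p : 'Hom(Y, N i)),
  [/\ forall k, k != i -> bijective (psi k), bijective p,
      forall j k, j != i -> k != i -> forall t,
        psi j (mact M j k t) = mact N j k (edge_lfun j (psi k) t),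
      forall j t, mact N i j (edge_lfun i (psi j) t) = p (e j t)
    & forall j y, out_comp N i j (p y) = edge_lfun i (psi j) (h j y)].
Proof.
pose T k := @dfwith 'I_n (fun k => vectType (subvs_of (kap k))) (fun k => M k) i Y k.
have Ti : T i = Y by rewrite /T dfwith_in.
have TM k : k != i -> T k = M k by move=> nki; rewrite /T dfwith_out // eq_sym.
clearbody T.
have /fin_all_exists[psi psiP] k : exists f : 'Hom(M k, T k), k != i -> bijective f.
  case: (eqVneq k i) => [_|nki]; first by exists 0.
  by rewrite (TM k nki); exists \1%VF => _; exists id => x; rewrite id_lfunE.
have [p pbij] : exists f : 'Hom(Y, T i), bijective f.
  by rewrite Ti; exists \1%VF; exists id => x; rewrite id_lfunE.
have psiK j := edge_bijK (psiP j).
pose off j k : 'Hom(edge j (T k), T j) :=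
  (psi j \o mact M j k \o edge_lfun j (psi k)^-1)%VF.
pose ein k : 'Hom(edge i (T k), T i) := (p \o e k \o edge_lfun i (psi k)^-1)%VF.
have /fin_all_exists[eout eoutP] j : exists g : 'Hom(edge j (T i), T j),
    i != j -> forall y, transpose g (p y) = edge_lfun i (psi j) (h j y).
  case: (eqVneq i j) => [_|nij]; first by exists 0.
  have [g gE] := transpose_exists nij (edge_lfun i (psi j) \o h j \o p^-1)%VF.
  by exists g => _ y; rewrite gE !comp_lfunE bij_lfunK.
pose act j : forall k, 'Hom(edge j (T k), T j) :=
  @dfwith 'I_n (fun j => forall k, 'Hom(edge j (T k), T j))
    (fun j k => @dfwith 'I_n (fun k => 'Hom(edge j (T k), T j)) (off j) i (eout j) k)
    i ein j.
have act_in k : act i k = ein k by rewrite /act dfwith_in.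
have act_out j : j != i -> act j i = eout j.
  by move=> nji; rewrite /act dfwith_out 1?eq_sym // dfwith_in.
have act_off j k : j != i -> k != i -> act j k = off j k.
  by move=> nji nki; rewrite /act dfwith_out 1?eq_sym // dfwith_out // eq_sym.
clearbody act.
pose P : path_module := @PathModule n C kappa K D T act.
have Poff j k : j != i -> k != i -> forall t,
    psi j (mact M j k t) = mact P j k (edge_lfun j (psi k) t).
  move=> nji nki t; rewrite [mact P j k]act_off // !comp_lfunE.
  by rewrite (proj1 (edge_bijK (fun=> psiP k nki))).
have Pin j t : mact P i j (edge_lfun i (psi j) t) = p (e j t).
  by rewrite [mact P i j]act_in !comp_lfunE (proj1 (psiK j)).
have Pout j y : out_comp P i j (p y) = edge_lfun i (psi j) (h j y).
  case: (eqVneq i j) => [<-|nij]; first exact: edge_self_eq.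
  by rewrite out_comp_transpose // [mact P j i]act_out 1?eq_sym // eoutP.
suff rel : preproj_relations P by exists (Defs.Module rel), psi, p; split.
apply/relationP => v m; case: (eqVneq v i) m => [->|nvi] m.
  rewrite -[m](bij_lfunVK pbij); set y := p^-1%VF m.
  rewrite -[RHS](linear0 p) -(eh0 y) linear_sum; apply: eq_bigr => j nji.
  by rewrite -out_comp_transpose 1?eq_sym // Pout Pin linearZ.
rewrite -[m](bij_lfunVK (psiP v nvi)); set x := (psi v)^-1%VF m.
have /relationP/(_ v x)/(congr1 (psi v)) := mrel (m := M).
rewrite linear0 => rel; rewrite -[RHS]rel linear_sum; apply: eq_bigr => j njv.
rewrite linearZ; congr (_ *: _); case: (eqVneq j i) njv => [->|nji] njv; last first.
  have /transpose_nat <- := Poff j v nji nvi; last by rewrite eq_sym.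
  by rewrite -Poff.
rewrite /transpose !linear_sum; apply: eq_bigr => a _.
rewrite !linear_sum; apply: eq_bigr => k _ /=.
have Dk : (bas D i v)`_k \in kap2 v i by rewrite bas_mem.
have Ddk : (dual_bas D i v)`_k \in kap2 i v by rewrite kap2C dual_bas_memP.
rewrite -(edge_lfun_pure (psi v) a x Dk) Pin.
(* both sides are pairings of an out-map, which [he] identifies *)
have adj (Q : path_module) z := @mact_out_comp Q i v (star D a) _ z njv Ddk.
by rewrite [LHS](adj P) (adj M) Pout he ev_nat // kap2C.
Qed.

End Surgery.

(** The inverse reflection functor: the new space is the cokernel of the
    out-map, and the new out-map exists because the preprojective relation
    makes the composite of the in-map and the out-map vanish on the image of the
    out-map. *)
Lemma refl_pair_coker i (N : module) : out_inj i N ->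
  exists (M : module) (phi : forall k, 'Hom(N k, M k)), refl_pair i phi.
Proof.
move=> oinj; have [Y [f [fsurj fexact]]] := coker_exists (out_comp N i).
pose e j := (-1) ^+ sgn D i j *: f j.
have eE j t : (-1) ^+ sgn D i j *: e j t = f j t by rewrite scale_lfunE signrZK.
have /fin_all_exists[h hE] k : exists h : 'Hom(Y, edge i (N k)),
    forall j t, h (f j t) = out_comp N i k (in_comp N i j t).
  have [||h hE] := @coker_factor _ _ _ Y (edge i (N k)) f
      (fun j => out_comp N i k \o in_comp N i j)%VF.
  - exact: fsurj.
  - move=> t /fexact[z zE]; rewrite -[RHS](linear0 (out_comp N i k)) -(in_out0 z).
    by rewrite linear_sum; apply: eq_bigr => j _; rewrite comp_lfunE zE.
  - by exists h => j t; rewrite hE comp_lfunE.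
have he j k t : h k (e j t) = out_comp N i k (mact N i j t).
  by rewrite scale_lfunE linearZ /= hE scale_lfunE !linearZ /= signrZK.
have eh0 y : \sum_(j | j != i) (-1) ^+ sgn D i j *: e j (h j y) = 0.
  have -> : \sum_(j | j != i) (-1) ^+ sgn D i j *: e j (h j y) = \sum_j f j (h j y).
    rewrite [RHS](bigD1 i) //= (edge_self (h i y)) linear0 add0r.
    by apply: eq_bigr => j _; rewrite eE.
  apply/fexact; have [t <-] := fsurj y; exists (\sum_l in_comp N i l (t l)) => j.
  by rewrite !linear_sum; apply: eq_bigr => l _; rewrite /= hE.
have [M [psi [p [psib pb Poff Pin Pout]]]] := surgery eh0 he.
have psiK j := edge_bijK (psib j).
have inP j t : in_comp M i j (edge_lfun i (psi j) t) = p (f j t).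
  by rewrite scale_lfunE Pin -eE linearZ.
exists M, psi; split=> //.
- move=> m; have [t tE] := fsurj (p^-1%VF m).
  exists (fun j => edge_lfun i (psi j) (t j)); rewrite -[RHS](bij_lfunVK pb) -tE.
  by rewrite linear_sum; apply: eq_bigr => j _; rewrite inP.
- move=> t; pose u j := edge_lfun i (psi j)^-1%VF (t j).
  have -> : \sum_j in_comp M i j (t j) = p (\sum_j f j (u j)).
    rewrite linear_sum; apply: eq_bigr => j _.
    by rewrite /= -inP (proj2 (psiK j)).
  rewrite -(linear0 p); split=> [/(bij_inj pb)/fexact[z zE]|[z zE]].
    by exists z => j; rewrite comp_lfunE zE (proj2 (psiK j)).
  congr (p _); apply/fexact; exists z => j.
  by rewrite /u -zE comp_lfunE (proj1 (psiK j)).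
- by move=> j k t; rewrite comp_lfunE Pin Pout he.
Qed.

(** The reflection functor: the new space is the kernel of the in-map. *)
Lemma refl_pair_ker i (M : module) : in_surj i M ->
  exists (N : module) (phi : forall k, 'Hom(N k, M k)), refl_pair i phi.
Proof.
move=> isurj; have [Z [o [oinj oexact]]] := ker_exists (in_comp M i).
have /fin_all_exists[e eE] j : exists e : 'Hom(edge i (M j), Z),
    forall t k, o k (e t) = out_comp M i k (mact M i j t).
  have [||e eE] := @ker_factor _ _ _ (edge i (M j)) Z o
      (fun k => out_comp M i k \o mact M i j)%VF.
  - exact: oinj.
  - move=> t; apply/oexact; rewrite -[RHS](in_out0 (mact M i j t)).
    by apply: eq_bigr => k _; rewrite comp_lfunE.
  - by exists e => t k; rewrite eE comp_lfunE.
have eh0 z : \sum_(j | j != i) (-1) ^+ sgn D i j *: e j (o j z) = 0.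
  apply: oinj => k; have /(congr1 (out_comp M i k)) : \sum_j in_comp M i j (o j z) = 0.
    by apply/oexact; exists z.
  rewrite linear0 linear_sum => E; rewrite -[RHS]E linear_sum [RHS](bigD1 i) //=.
  rewrite (edge_self (o i z)) !linear0 add0r; apply: eq_bigr => j _.
  by rewrite linearZ /= eE scale_lfunE linearZ.
have oe j k t : o k (e j t) = out_comp M i k (mact M i j t) by rewrite eE.
have [N [psi [p [psib pb Poff Pin Pout]]]] := surgery eh0 oe.
have psiK j := edge_bijK (psib j).
have out_p j z : out_phi i (fun k => (psi k)^-1%VF) j (p z) = o j z.
  by rewrite comp_lfunE Pout (proj1 (psiK j)).
exists N, (fun k => (psi k)^-1%VF); split=> //.
- by move=> k nki; apply/bij_lfunV/psib.
- move=> j k nji nki t; apply: (bij_inj (psib j nji)).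
  rewrite bij_lfunVK; last exact: psib.
  rewrite (Poff j k nji nki (edge_lfun j (psi k)^-1%VF t)) edge_lfunV //.
  exact: psib.
- move=> m m0; rewrite -[m](bij_lfunVK pb); set z := p^-1%VF m.
  suff -> : z = 0 by rewrite linear0.
  apply: oinj => j; rewrite -out_p comp_lfunE /z bij_lfunVK // m0 linear0.
  by [].
- move=> t; split=> [/oexact[z zE]|[m mE]].
    by exists (p z) => j; rewrite out_p.
  apply/oexact; exists (p^-1%VF m) => j.
  by rewrite -out_p bij_lfunVK // mE.
- move=> j k t; rewrite -{1}[t](proj2 (psiK j)) Pin out_p oe.
  by [].
Qed.

(** * Reflection functors *)

Lemma iso_offP i (M N : module) (phi : forall k, 'Hom(M k, N k)) :
  iso_off i phi <->
  (forall k, k != i -> bijective (phi k)) /\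
  (forall j k, j != i -> k != i -> forall t,
     phi j (mact M j k t) = mact N j k (edge_lfun j (phi k) t)).
Proof.
split=> -[phib phiM]; split=> // j k nji nki.
  by apply/eq_edge_map_lfun => a x m; apply: phiM.
by apply/eq_edge_map_lfun => t; apply: phiM.
Qed.

Lemma in_map_at i (M : module) j (t : edge i (M j)) :
  in_map (@dfwith 'I_n (fun k => edge i (M k)) (fun=> 0) j t) = in_comp M i j t.
Proof.
rewrite in_mapE (bigD1 j) //= dfwith_in big1 ?addr0 // => k njk.
by rewrite dfwith_out 1?eq_sym // linear0.
Qed.


Lemma around_mapE i (M N : module) (phi : forall k, 'Hom(M k, N k))
    (t : around i M) j : around_map phi t j = edge_lfun i (phi j) (t j).
Proof. by rewrite edge_lfunE. Qed.

Lemma in_around_at i (M N : module) (phi : forall k, 'Hom(M k, N k)) j (t : edge i (M j)) :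
  in_map (around_map phi (@dfwith 'I_n (fun k => edge i (M k)) (fun=> 0) j t))
  = in_comp N i j (edge_lfun i (phi j) t).
Proof.
rewrite in_mapE (bigD1 j) //= around_mapE dfwith_in big1 ?addr0 // => k njk.
by rewrite around_mapE dfwith_out 1?eq_sym // !linear0.
Qed.

Lemma Sigma_plusP i (M N : module) :
  Sigma_step true i M N <-> exists phi : forall k, 'Hom(N k, M k), refl_pair i phi.
Proof.
split=> [[/no_quotP surj [phi [iota [/iso_offP[phib phiM] inj ex out inn]]]]|].
  have iotaE j m : iota j m = out_phi i phi j m.
    by rewrite comp_lfunE -out around_mapE out_compE.
  exists phi; split=> //.
  - move=> m m0; apply: inj => j; rewrite iotaE comp_lfunE m0; exact: linear0.
  - move=> t; rewrite -in_mapE ex.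
    by split=> -[m mE]; exists m => j; rewrite -mE iotaE.
  - move=> j k t; have := inn (dfwith (T := fun k => edge i (N k)) (fun=> 0) t) k.
    rewrite in_map_at in_around_at iotaE -out_compE !scale_lfunE !linearZ /=.
    by move/(can_inj (signrZK _)).
move=> [phi MN]; split; first by apply/no_quotP/(rp_surj MN).
exists phi, (out_phi i phi); split.
- apply/iso_offP; split=> [k|j k nji nki]; first exact: (rp_bij MN).
  exact: (rp_off MN nji nki).
- exact: rp_out_phi_inj MN.
- by move=> t; rewrite in_mapE; apply: rp_exact MN t.
- by move=> m j; rewrite around_mapE -out_compE comp_lfunE.
- move=> t j; rewrite !in_mapE -out_compE !linear_sum; apply: eq_bigr => k _ /=.
  by rewrite !scale_lfunE !linearZ /= around_mapE (rp_comm MN).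
Qed.

(** The cokernel sequence of [N] is the kernel sequence of [M], so the inverse
    functor is governed by the same relation. *)
Lemma Sigma_minusP i (M N : module) :
  Sigma_step false i N M <-> exists phi : forall k, 'Hom(N k, M k), refl_pair i phi.
Proof.
split=> [[/no_subP inj [psi [pi [/iso_offP[psib psiM] surj ex inn out]]]]|].
  have psiK j := edge_bijK (psib j).
  pose phi k := (psi k)^-1%VF.
  have projE (t : around i N) :
      \sum_(j | j != i) pi j (t j) = \sum_j in_comp M i j (edge_lfun i (phi j) (t j)).
    rewrite -[RHS](in_mapE (fun j => edge_lfun i (phi j) (t j))) inn.
    by apply: eq_bigr => j _; rewrite around_mapE (proj2 (psiK j)).
  exists phi; split=> //.
  - by move=> k nki; apply/bij_lfunV/psib.
  - move=> j k nji nki t; apply: (bij_inj (psib j nji)).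
    rewrite bij_lfunVK; last exact: psib.
    rewrite (psiM j k nji nki (edge_lfun j (phi k) t)) edge_lfunV //.
    exact: psib.
  - move=> m; have [t <-] := surj m; rewrite projE.
    by exists (fun j => edge_lfun i (phi j) (t j)).
  - move=> t; rewrite -in_mapE inn; split=> [/ex[m mE]|[m mE]].
      exists m => j; rewrite comp_lfunE out_compE -mE around_mapE.
      by rewrite (proj1 (psiK j)).
    apply/ex; exists m => j; rewrite around_mapE -mE comp_lfunE.
    by rewrite (proj2 (psiK j)) out_compE.
  - move=> j k t; have := out (dfwith (T := fun k => edge i (N k)) (fun=> 0) t) k.
    rewrite in_map_at around_mapE projE -!out_compE (bigD1 j) //= dfwith_in.
    rewrite big1 ?addr0 => [|l nlj]; last first.
      by rewrite dfwith_out 1?eq_sym // !linear0.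
    move/(congr1 (edge_lfun i (phi k))); rewrite (proj1 (psiK k)).
    rewrite !scale_lfunE !linearZ /= => /(can_inj (signrZK _)) ->.
    by rewrite comp_lfunE.
move=> [phi MN]; split; first by apply/no_subP/(rp_inj MN).
have phiK j := edge_bijK (rp_bij MN (k := j)).
exists (fun k => (phi k)^-1%VF), (fun j => in_comp M i j \o edge_lfun i (phi j))%VF => proj.
have projE t : proj t = \sum_j in_comp M i j (edge_lfun i (phi j) (t j)).
  rewrite /proj [RHS](bigD1 i) //= (edge_self (edge_lfun i (phi i) (t i))).
  by rewrite linear0 add0r; apply: eq_bigr => j _; rewrite comp_lfunE.
split.
- apply/iso_offP; split=> [k nki|j k nji nki t]; first exact: bij_lfunV (rp_bij MN nki).
  have phij := rp_bij MN nji; have phik := rp_bij MN nki.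
  apply: (bij_inj phij); rewrite (bij_lfunVK phij).
  by rewrite (rp_off MN nji nki (edge_lfun j (phi k)^-1%VF t)) (edge_lfunV _ phik).
- move=> m; have [t <-] := rp_surj MN m.
  exists (fun j => edge_lfun i (phi j)^-1%VF (t j)); rewrite projE.
  by apply: eq_bigr => j _; rewrite (proj2 (phiK j)).
- move=> t; rewrite projE (rp_exact MN (fun j => edge_lfun i (phi j) (t j))).
  split=> -[m mE]; exists m => j.
    by rewrite -out_compE -[t j](proj1 (phiK j)) -mE comp_lfunE (proj1 (phiK j)).
  by rewrite mE -out_compE comp_lfunE.
- move=> t; rewrite in_mapE projE; apply: eq_bigr => j _.
  by rewrite around_mapE (proj2 (phiK j)).
- move=> t j; rewrite around_mapE -!out_compE projE in_mapE.
  rewrite -[RHS](proj1 (phiK j)); congr (edge_lfun i _ _).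
  rewrite !linear_sum; apply: eq_bigr => k _ /=.
  rewrite !scale_lfunE !linearZ /= -(rp_comm MN) comp_lfunE.
  by [].
Qed.

(** * Isomorphisms *)

Lemma isomorphic_refl (M : module) : isomorphic M M.
Proof.
have [|f fE] := @mk_hom M M (fun k => \1%VF).
  by move=> i j t; rewrite edge_lfun1 id_lfunE.
by exists f, f => k; split=> x; rewrite fE !id_lfunE.
Qed.

Lemma isomorphic_sym (M N : module) : isomorphic M N -> isomorphic N M.
Proof. by move=> [f [g fgK]]; exists g, f => k; have [] := fgK k. Qed.

Lemma isomorphicP (M N : module) : isomorphic M N ->
  exists f : hom M N, forall k, bijective (f k).
Proof. by move=> [f [g fgK]]; exists f => k; have [? ?] := fgK k; exists (g k). Qed.

Lemma refl_pair_isol i (M M' N : module) (phi : forall k, 'Hom(N k, M k)) :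
  isomorphic M M' -> refl_pair i phi ->
  exists phi' : forall k, 'Hom(N k, M' k), refl_pair i phi'.
Proof.
move=> /isomorphicP[f fb] MN; have fK j := edge_bijK (fun _ : j != i => fb j).
have inf j t : in_comp M' i j (edge_lfun i (f j) t) = f i (in_comp M i j t).
  by apply/esym/mact_in_comp/hom_mact.
pose phi' k := (f k \o phi k)%VF; exists phi'.
have out' j m : out_phi i phi' j m = edge_lfun i (f j) (out_phi i phi j m).
  by rewrite !comp_lfunE edge_lfun_comp.
split.
- move=> k nki; have [p pK Kp] := rp_bij MN nki; have [q qK Kq] := fb k.
  by exists (p \o q) => x /=; rewrite comp_lfunE ?qK ?pK ?Kp ?Kq.
- move=> j k nji nki t; rewrite edge_lfun_comp comp_lfunE (rp_off MN) //.
  exact: hom_mact.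
- exact: rp_inj MN.
- move=> m; have [t tE] := rp_surj MN ((f i)^-1%VF m).
  exists (fun j => edge_lfun i (f j) (t j)).
  rewrite -[RHS](bij_lfunVK (fb i)) -tE linear_sum.
  by apply: eq_bigr => j _; rewrite inf.
- move=> t; pose u j := edge_lfun i (f j)^-1%VF (t j).
  have -> : \sum_j in_comp M' i j (t j) = f i (\sum_j in_comp M i j (u j)).
    by rewrite linear_sum; apply: eq_bigr => j _; rewrite /= -inf (proj2 (fK j)).
  rewrite -(linear0 (f i)); split=> [/(bij_inj (fb i))/(rp_exact MN)[m mE]|[m mE]].
    by exists m => j; rewrite out' mE (proj2 (fK j)).
  congr (f i _); apply/(rp_exact MN); exists m => j.
  by rewrite /u -mE out' (proj1 (fK j)).
- move=> j k t; rewrite out' (rp_comm MN) edge_lfun_comp.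
  by rewrite (hom_out_comp f) (hom_mact f (edge_lfun i (phi j) t)).
Qed.

Lemma refl_pair_isor i (M N N' : module) (phi : forall k, 'Hom(N k, M k)) :
  isomorphic N N' -> refl_pair i phi ->
  exists phi' : forall k, 'Hom(N' k, M k), refl_pair i phi'.
Proof.
move=> /isomorphic_sym/isomorphicP[f fb] MN.
have fK j := edge_bijK (fun _ : j != i => fb j).
pose phi' k := (phi k \o f k)%VF; exists phi'.
have out' j m : out_phi i phi' j m = out_phi i phi j (f i m).
  by rewrite !comp_lfunE edge_lfun_comp (hom_out_comp f).
split.
- move=> k nki; have [p pK Kp] := rp_bij MN nki; have [q qK Kq] := fb k.
  by exists (q \o p) => x /=; rewrite comp_lfunE ?pK ?qK ?Kq ?Kp.
- move=> j k nji nki t.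
  rewrite edge_lfun_comp comp_lfunE (hom_mact f t) (rp_off MN) //.
- move=> m m0; apply: (bij_inj (fb i)); rewrite linear0; apply: (rp_inj MN) => j.
  by rewrite -(hom_out_comp f) m0 linear0.
- exact: rp_surj MN.
- move=> t; rewrite (rp_exact MN); split=> -[m mE].
    by exists ((f i)^-1%VF m) => j; rewrite out' (bij_lfunVK (fb i)) mE.
  by exists (f i m) => j; rewrite -mE out'.
- move=> j k t; rewrite out' (hom_mact f t) (rp_comm MN) edge_lfun_comp.
  by [].
Qed.

Lemma Sigma_step_iso (e : bool) i (M M' N : module) :
  isomorphic M M' -> Sigma_step e i M' N -> Sigma_step e i M N.
Proof.
move=> /isomorphic_sym MM'; case: e.
  move=> /Sigma_plusP[phi MN]; apply/Sigma_plusP; exact: refl_pair_isol MN.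
move=> /Sigma_minusP[phi MN]; apply/Sigma_minusP; exact: refl_pair_isor MN.
Qed.

(** In a word, isomorphisms are only inserted at the end; adding a step moves
    this isomorphism to the source of the step. *)
Lemma Sigma_word_rcons w (e : bool) i (M M' N : module) :
  is_Sigma_word w M M' -> Sigma_step e i M' N -> is_Sigma_word (rcons w (i, e)) M N.
Proof.
elim: w M => [|[k d] w IHw] M /=.
  move=> MM' M'N; exists N; last exact: isomorphic_refl.
  exact: Sigma_step_iso MM' M'N.
by move=> [M1 MM1 M1M'] M'N; exists M1 => //; apply: IHw.
Qed.

Section IsoInvariance.
Variable R : realType.

Lemma iso_mdim (M N : module) : isomorphic M N -> mdim R M = mdim R N.
Proof.
by move=> /isomorphicP[f fb]; apply/rowP => k; rewrite !mxE (bij_dim_eq (fb k)).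
Qed.

Lemma iso_brick (M N : module) : isomorphic M N -> brick M -> brick N.
Proof.
move=> MN /brickP[[k [m m0]] brM]; have [f [g fgK]] := MN.
apply/brickP; split.
  exists k, (f k m); rewrite -(linear0 (f k)) (inj_eq (can_inj (proj1 (fgK k)))).
  exact: m0.
move=> h [l hl0].
have [|h' h'E] := @mk_hom M M (fun k => g k \o h k \o f k)%VF.
  move=> i j t; rewrite !edge_lfun_comp 2!comp_lfunE (hom_mact f t).
  by rewrite (hom_mact h (edge_lfun j (f i) t)) (hom_mact g (edge_lfun j (h i) _)).
have /brM h'inj : exists k, h' k != 0.
  exists l; apply: contraNneq hl0 => h'0; apply/eqP/lfunP => x.
  have := congr1 (fun u : 'End(M l) => f l (u (g l x))) h'0.
  rewrite h'E !comp_lfunE !(proj2 (fgK l)) => ->.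
  by rewrite !zero_lfunE linear0.
move=> l' x y hxy; apply: (can_inj (proj2 (fgK l'))); apply: (h'inj l').
by rewrite h'E !comp_lfunE !(proj2 (fgK l')) hxy.
Qed.

Lemma iso_semistable (M N : module) (theta : 'Hom('rV[R]_n, R^o)) :
  isomorphic M N -> semistable theta M -> semistable theta N.
Proof.
move=> MN; rewrite /semistable (iso_mdim MN) => -[-> stab]; split=> // U.
have [f fb] := isomorphicP MN; move=> /submoduleP subU.
have <- : dimvec R (fun k => f k @^-1: U k)%VS = dimvec R U.
  apply/rowP => k; rewrite !mxE -[in RHS](preim_bij_img (U k) (fb k)).
  by rewrite (dim_limg_inj _ (bij_inj (fb k))).
apply: stab; apply/submoduleP => j k t Ut.
rewrite -memv_preim (hom_mact f t); apply: subU; move: Ut.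
elim/edge_sub_ind => [|u v Su Sv|a x u Dx Vu].
- by rewrite linear0 mem0v.
- by rewrite linearD memvD.
- by rewrite edge_lfun_pure // mem_edge_sub_pure // memv_preim.
Qed.

Lemma iso_Stab (M N : module) : isomorphic M N -> Stab M = Stab N :> set 'Hom('rV[R]_n, R^o).
Proof.
move=> MN; apply/seteqP; split=> theta; apply: iso_semistable => //.
exact: isomorphic_sym.
Qed.

End IsoInvariance.

(** * Simple modules *)

Section RealCoefficients.
Variable R : realType.
Local Notation alpha := (alpha R).
Local Notation form := Defs.form.

Lemma dim_simple j k : \dim {:simple_module D j k} = (k == j).
Proof. by rewrite dimvf /dim /= mul1n. Qed.

Lemma mdim_simple j : mdim R (simple_module D j) = alpha j.
Proof. by apply/rowP => k; rewrite !mxE dim_simple eqxx. Qed.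

Lemma dimv_eq0_zero (F : fieldType) (V : vectType F) (v : V) :
  \dim {:V} = 0%N -> v = 0.
Proof. by move/eqP; rewrite dimv_eq0 => /eqP V0; apply/eqP; rewrite -memv0 -V0 memvf. Qed.

Lemma brick_simple j : brick (simple_module D j).
Proof.
apply/brickP; split; first by exists j, (const_mx 1); apply: simple_one_neq0.
move=> f [k fk] l x y; case: (eqVneq l j) x y => [->|nlj] x y; last first.
  by move=> _; rewrite (simple_off x nlj) (simple_off y nlj).
have kj : k = j.
  apply: contraNeq fk => nkj; apply/eqP/lfunP => z; rewrite (simple_off z nkj).
  by rewrite !linear0.
rewrite {}kj in fk; have f1 : f j (const_mx 1) != 0.
  apply: contraNneq fk => f1; apply/eqP/lfunP => z; have [c ->] := simple_self z.
  by rewrite linearZ /= f1 scaler0 zero_lfunE.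
have [c ->] := simple_self x; have [d ->] := simple_self y.
move/eqP; rewrite -subr_eq0 -linearB -scalerBl linearZ /= scaler_eq0 (negPf f1).
by rewrite orbF subr_eq0 => /eqP ->.
Qed.

Lemma dimvec_simple j (U : forall k, {vspace simple_module D j k}) :
  dimvec R U = (\dim (U j))%:R *: alpha j.
Proof.
suff dimE (k : 'I_n) (d e : nat) : (k = j -> d = e) -> (d <= (k == j))%N ->
    d%:R = e%:R * (k == j)%:R :> R.
  apply/rowP => k; rewrite !mxE eqxx /=; apply: dimE => [-> //|].
  by apply: leq_trans (dimvS (subvf _)) _; rewrite dim_simple.
case: eqP => [-> -> //|_ _]; first by rewrite mulr1.
by rewrite leqn0 mulr0 => /eqP ->.
Qed.

Lemma Stab_simple j : Stab (simple_module D j) = perp (alpha j).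
Proof.
apply/seteqP; split=> theta; rewrite /Stab /perp /=.
  by case; rewrite mdim_simple.
move=> th0; split; first by rewrite mdim_simple.
by move=> U _; rewrite dimvec_simple linearZ /= th0 scaler0.
Qed.

(** There is only one nonzero space, and there are no arrows from a vertex to
    itself. *)
Lemma simple_iso j (B : module) : mdim R B = alpha j -> isomorphic (simple_module D j) B.
Proof.
move=> dimB; have dimBk k : \dim {:B k} = (k == j).
  have /rowP/(_ k) := dimB; rewrite !mxE eqxx /= => /eqP.
  by rewrite eqr_nat => /eqP.
have B0 k (x : B k) : k != j -> x = 0.
  by move=> nkj; apply: dimv_eq0_zero; rewrite dimBk (negPf nkj).
have /fin_all_exists[f fb] k : exists f : 'Hom(simple_module D j k, B k), bijective f.
  by apply: eq_dim_iso; rewrite dim_simple dimBk.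
have mactB i k t : mact B i k t = 0.
  case: (eqVneq k i) t => [->|nki] t; first exact: mact_self.
  case: (eqVneq i j) nki t => [->|nij] nki t; last exact: B0.
  elim/edge_ind: t => [|t u ft fu|a x u Dx]; first exact: linear0.
    by rewrite linearD /= ft fu addr0.
  by rewrite (B0 k u nki) epure0r // linear0.
have [|h hE] := @mk_hom (simple_module D j) B f.
  by move=> i k t; rewrite mactB mact_simple linear0.
have [|g gE] := @mk_hom B (simple_module D j) (fun k => (f k)^-1%VF).
  by move=> i k t; rewrite mactB mact_simple linear0.
exists h, g => k; rewrite hE gE; split; first exact: bij_lfunK (fb k).
exact: bij_lfunVK (fb k).
Qed.

(** * Stability spaces along a reflection *)

Section StabStep.
Variables (i : 'I_n) (M N : module) (phi : forall k, 'Hom(N k, M k)).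
Hypothesis MN : refl_pair i phi.

(** The out-map of [M] lands in the kernel of its in-map, which is [N i].  The
    resulting map from [M i] to [N i] has the same image as the in-map of [N]
    and the same kernel as the out-map of [M]; comparing dimensions therefore
    shows which of the two modules has the simple module at [i] as a quotient
    or a submodule. *)
Lemma rp_shift : exists h : 'Hom(M i, N i),
  (forall j m, out_phi i phi j (h m) = out_comp M i j m) /\
  (forall j t, mact N i j t = h (mact M i j (edge_lfun i (phi j) t))).
Proof.
have [||h hE] := @ker_factor _ _ _ (M i) (N i) (out_phi i phi) (out_comp M i).
- exact: rp_out_phi_inj MN.
- by move=> m; apply/(rp_exact MN); apply: in_out0.
exists h; split=> // j t; apply/eqP; rewrite -subr_eq0; apply/eqP.
apply: (rp_out_phi_inj MN) => k; rewrite linearB /= hE (rp_comm MN).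
exact: subrr.
Qed.

Lemma rp_dim_form :
  form C (coroot R C i) (mdim R N) = (\dim {:N i})%:R - (\dim {:M i})%:R.
Proof.
rewrite (rp_mdim MN) form_coroot_refl.
have /rowP/(_ i) := rp_mdim MN R; rewrite /refl !mxE !eqxx mulr1 => ->.
by rewrite addrAC subrr add0r.
Qed.

(** When [N i] is bigger than [M i], the simple module at [i] is a quotient of
    [N], so a stability condition for [N] is nonpositive on [alpha i]. *)
Lemma rp_Stab_le0 (theta : 'Hom('rV[R]_n, R^o)) :
  (\dim {:M i} < \dim {:N i})%N -> semistable theta N -> theta (alpha i) <= 0.
Proof.
move=> ltMN [thN stab]; have [h [_ hE]] := rp_shift.
pose U := dfwith (T := fun k => {vspace N k}) (fun=> fullv) (limg h).
have subU : is_submodule U.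
  apply/submoduleP => j k t _; rewrite /U; case: (eqVneq j i) t => [->|nji] t.
    by rewrite dfwith_in hE memv_img ?memvf.
  by rewrite dfwith_out ?memvf // eq_sym.
have := stab U subU; have := thN.
rewrite /mdim (dimvec_dfwith R (fun=> fullv) (limg h)) -/U linearD linearZ /=.
move=> /eqP; rewrite addr_eq0 => /eqP ->; rewrite oppr_ge0 pmulr_rle0 //.
rewrite subr_gt0 ltr_nat; apply: leq_ltn_trans ltMN.
by have := limg_ker_dim h fullv => <-; apply: leq_addl.
Qed.

(** Dually, when [M i] is bigger than [N i], the simple module at [i] embeds
    in [M]. *)
Lemma rp_Stab_ge0 (theta : 'Hom('rV[R]_n, R^o)) :
  (\dim {:N i} < \dim {:M i})%N -> semistable theta M -> 0 <= theta (alpha i).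
Proof.
move=> ltNM [_ stab]; have [h [hE _]] := rp_shift.
pose U := dfwith (T := fun k => {vspace M k}) (fun=> 0%VS) (lker h).
have Ui : U i = lker h by rewrite /U dfwith_in.
have U0 k : k != i -> U k = 0%VS by move=> nki; rewrite /U dfwith_out // eq_sym.
have subU : is_submodule U.
  apply/submoduleP => j k t; case: (eqVneq j i) t => [->|nji] t.
    case: (eqVneq k i) t => [->|nki] t; first by rewrite mact_self mem0v.
    rewrite U0 //; elim/edge_sub_ind => [|u v Su Sv|a x m Dx].
    - by rewrite linear0 mem0v.
    - by rewrite linearD memvD.
    - by rewrite memv0 => /eqP ->; rewrite epure0r // linear0 mem0v.
  case: (eqVneq k i) t => [->|nki] t; last first.
    rewrite (U0 k) //; elim/edge_sub_ind => [|u v Su Sv|a x m Dx].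
    - by rewrite linear0 mem0v.
    - by rewrite linearD memvD.
    - by rewrite memv0 => /eqP ->; rewrite epure0r // linear0 mem0v.
  move: t; apply/submodule_out => [|m]; first by rewrite eq_sym.
  by rewrite Ui memv_ker -hE => /eqP ->; rewrite linear0 mem0v.
have := stab U subU; suff -> : dimvec R U = (\dim (lker h))%:R *: alpha i.
  rewrite linearZ /= pmulr_rge0 // ltr0n -(ltn_add2r (\dim (limg h))).
  have := limg_ker_dim h fullv; rewrite capfv => ->; rewrite add0n.
  by apply: leq_ltn_trans ltNM; apply: dimvS; apply: subvf.
apply/rowP => k; rewrite !mxE eqxx /=; case: (eqVneq k i) => [->|nki].
  by rewrite Ui mulr1.
by rewrite U0 // dimv0 mulr0.
Qed.

End StabStep.

Lemma Stab_plus i (M N : module) : 0 < form C (coroot R C i) (mdim R N) ->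
  Sigma_step true i M N -> Stab N = sigma_cone (R := R) C true i (Stab M).
Proof.
move=> posN /Sigma_plusP[phi MN].
have ltMN : (\dim {:M i} < \dim {:N i})%N.
  by move: posN; rewrite (rp_dim_form MN) subr_gt0 ltr_nat.
apply/seteqP; split=> theta.
  move=> Nth; have th0 := rp_Stab_le0 MN ltMN Nth.
  by apply/sigma_coneE; split=> //; apply/(rp_semistable MN).
by move/sigma_coneE => [Mth th0]; apply/(rp_semistable MN).
Qed.

Lemma Stab_minus i (M N : module) : 0 < form C (coroot R C i) (mdim R M) ->
  Sigma_step false i N M -> Stab M = sigma_cone (R := R) C false i (Stab N).
Proof.
move=> posM /Sigma_minusP[phi MN].
have ltNM : (\dim {:N i} < \dim {:M i})%N.
  have := rp_dim_form MN; rewrite (rp_mdim MN) form_coroot_refl => E.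
  by move: posM; rewrite -oppr_lt0 E subr_lt0 ltr_nat.
have semi (theta : 'Hom('rV[R]_n, R^o)) : 0 <= theta (alpha i) ->
    semistable (dual_refl C i theta) N <-> semistable theta M.
  move=> th0; have := rp_semistable MN (theta := dual_refl C i theta).
  by rewrite dual_reflK dual_refl_alpha oppr_le0; apply.
apply/seteqP; split=> theta.
  move=> Mth; have th0 := rp_Stab_ge0 MN ltNM Mth.
  by apply/sigma_coneE; split=> //; apply/semi.
by move/sigma_coneE => [Nth th0]; apply/semi.
Qed.

Lemma Stab_step (e : bool) i (M N : module) : 0 < form C (coroot R C i) (mdim R N) ->
  Sigma_step e i M N -> Stab N = sigma_cone (R := R) C e i (Stab M).
Proof. by case: e; [apply: Stab_plus | apply: Stab_minus]. Qed.

Lemma mdim_neq0P (M : module) : (exists k (m : M k), m != 0) <-> mdim R M != 0.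
Proof.
split=> [[k [m m0]]|].
  apply: contraNneq m0 => /rowP/(_ k); rewrite !mxE => /eqP; rewrite pnatr_eq0.
  by move=> /eqP M0; apply/eqP/dimv_eq0_zero.
move=> dM; have [k dk] : exists k, mdim R M 0 k != 0.
  apply/existsP; rewrite -negb_forall; apply: contra dM => /forallP d0.
  by apply/eqP/rowP => k; have := d0 k; rewrite [RHS]mxE; case: eqP.
exists k, (vpick fullv); rewrite vpick0 -dimv_eq0.
by move: dk; rewrite mxE pnatr_eq0.
Qed.

Lemma refl_eq0 i (v : 'rV[R]_n) : (refl C i v == 0) = (v == 0).
Proof. by rewrite -(inj_eq (can_inj (reflK C i))) reflK linear0. Qed.

Lemma Sigma_step_mdim (e : bool) i (M N : module) :
  Sigma_step e i M N -> mdim R N = refl C i (mdim R M).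
Proof.
case: e => [/Sigma_plusP[phi MN]|/Sigma_minusP[phi MN]]; first exact: rp_mdim MN R.
by rewrite (rp_mdim MN) reflK.
Qed.

Lemma Sigma_step_brick (e : bool) i (M N : module) :
  Sigma_step e i M N -> brick M <-> brick N.
Proof.
move=> MN; have dimN := Sigma_step_mdim MN.
have nz : (exists k (m : M k), m != 0) <-> (exists k (m : N k), m != 0).
  by rewrite !mdim_neq0P dimN refl_eq0.
split=> br; have nzs := br.1.
  have N0 := proj1 nz nzs.
  case: e MN => [/Sigma_plusP[phi MN]|/Sigma_minusP[phi MN]].
    exact: rp_brick_push MN N0 br.
  exact: rp_brick_pull MN N0 br.
have M0 := proj2 nz nzs.
case: e MN => [/Sigma_plusP[phi MN]|/Sigma_minusP[phi MN]].
  exact: rp_brick_pull MN M0 br.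
exact: rp_brick_push MN M0 br.
Qed.

(** Otherwise the composite of a surjection to the simple module and of an
    injection from it is a nonzero endomorphism, hence an isomorphism. *)
Lemma brick_out_or_in i (B : module) : brick B -> mdim R B != alpha i ->
  out_inj i B \/ in_surj i B.
Proof.
move=> /brickP[_ br] /eqP Bi; rewrite -no_subP -no_quotP.
apply: contrapT => /not_orP[/contrapT[f finj] /contrapT[g gsurj]]; apply: Bi.
have [|h hE] := @mk_hom B B (fun k => f k \o g k)%VF.
  move=> j k t; rewrite edge_lfun_comp comp_lfunE (hom_mact g t).
  by rewrite (hom_mact f (edge_lfun k (g j) t)).
have /br hinj : exists k, h k != 0.
  exists i; have [m gm] := gsurj i (const_mx 1).
  apply: contraNneq (simple_one_neq0 i) => h0; apply/eqP/(finj i).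
  have := congr1 (fun u : 'End(B i) => u m) h0.
  by rewrite hE comp_lfunE gm zero_lfunE linear0.
rewrite -mdim_simple; apply/rowP => k; rewrite !mxE; congr (_%:R).
apply: (@bij_dim_eq _ _ _ (g k)); apply/lfun_bij; split; last first.
  exact: (proj1 (lfun_surj (g k)) (gsurj k)).
apply/eqP/lker0P => x y gxy; apply: (hinj k).
by rewrite hE !comp_lfunE gxy.
Qed.

(** * Words of reflection functors *)

(** The positivity hypothesis says that each step of the word increases the
    dimension, which is what [Stab_step] requires. *)
Lemma Sigma_word_spec (w : seq ('I_n * bool)) (M N : module) :
  brick M -> is_Sigma_word w M N ->
  (forall s1 i s2, unzip1 w = s1 ++ i :: s2 ->
     0 < form C (coroot R C i) (apply_word C (rcons s1 i) (mdim R M))) ->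
  [/\ brick N, mdim R N = apply_word C (unzip1 w) (mdim R M)
    & Stab N = sigma_cone_word (R := R) C w (Stab M)].
Proof.
elim: w M => [|[i e] w IHw] M brM /=.
  move=> MN _; split; first exact: iso_brick MN brM.
    by rewrite (iso_mdim R (isomorphic_sym MN)).
  by rewrite (iso_Stab R MN).
move=> [M1 MM1 M1N] pos; have dimM1 := Sigma_step_mdim MM1.
have brM1 : brick M1 by apply/(Sigma_step_brick MM1).
have [|brN dimN StabN] := IHw M1 brM1 M1N.
  move=> s1 k s2 wE; have := pos (i :: s1) k s2; rewrite wE => /(_ erefl).
  by rewrite dimM1.
split=> //; first by rewrite dimN dimM1.
rewrite StabN (Stab_step _ MM1) //.
by have := pos [::] i (unzip1 w) erefl; rewrite dimM1.
Qed.

(** Induction from the end of the expression: the last functor is undone on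
    [B], with the sign dictated by [brick_out_or_in]. *)
Lemma Sigma_word_exists (s : seq 'I_n) j beta (B : module) :
  positive_expression C s j beta -> brick B -> mdim R B = beta ->
  exists2 e : seq bool, size e = size s & is_Sigma_word (zip s e) (simple_module D j) B.
Proof.
elim/last_ind: s beta B => [|s i IHs] beta B.
  move=> [-> _] _ /simple_iso SB; exists [::] => //.
move=> /positive_expression_rcons[pos betaE _] brB dimB.
have gE : apply_word C s (alpha j) = refl C i (mdim R B).
  by rewrite dimB betaE reflK.
have Bi : mdim R B != alpha i.
  apply/eqP => Bi; have := positive_expression_ge0 pos i.
  by rewrite gE Bi refl_alpha !mxE !eqxx oppr_ge0 ler10.
suff [M [e MB]] : exists (M : module) e, Sigma_step e i M B.
  have brM : brick M by apply/(Sigma_step_brick MB).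
  have [|es ses w] := IHs _ M pos brM.
    by rewrite gE (Sigma_step_mdim MB) reflK.
  exists (rcons es e); first by rewrite !size_rcons ses.
  by rewrite zip_rcons //; apply: Sigma_word_rcons w MB.
have [/refl_pair_coker[M [phi MB]]|/refl_pair_ker[M [phi MB]]] := brick_out_or_in brB Bi.
  by exists M, true; apply/Sigma_plusP; exists phi.
by exists M, false; apply/Sigma_minusP; exists phi.
Qed.

End RealCoefficients.

End PreprojectiveModules.

Theorem theorem1p11 (R : realType) (n : nat) (C : cartan_datum n)
    (kappa : fieldType) (K : splittingFieldType kappa)
    (K_galois : galois 1%VS {:K}%VS)
    (K_cyclic : cyclic 'Gal({:K}%VS / 1%VS)%g)
    (K_order : #|'Gal({:K}%VS / 1%VS)%g| = total_lcm C)
    (D : preproj_datum C K)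
    (beta : 'rV[R]_n) (beta_pos : is_positive_root C beta)
    (s : seq 'I_n) (j : 'I_n) (s_pos : positive_expression C s j beta)
    (B : module D) :
  (shard_module R B /\ mdim R B = beta) <->
  (exists2 e : seq bool, size e = size s &
     is_Sigma_word (zip s e) (simple_module D j) B /\
     cone_has_dim (sigma_cone_word C (zip s e) (perp (alpha R j))) n.-1).
Proof.
have word_spec e : size e = size s -> is_Sigma_word (zip s e) (simple_module D j) B ->
    [/\ brick B, mdim R B = beta
      & Stab B = sigma_cone_word C (zip s e) (perp (alpha R j))].
  move=> se w; have unz : unzip1 (zip s e) = s by rewrite unzip1_zip ?se.
  have brS := brick_simple K_galois K_cyclic D j.
  have [|brB dimB StabB] := Sigma_word_spec K_galois K_cyclic (R := R) brS w.
    rewrite unz mdim_simple => s1 i s2 sE.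
    exact: positive_expression_form s_pos sE.
  split=> //; last by rewrite StabB Stab_simple.
  by rewrite dimB unz mdim_simple; case: s_pos.
split=> [[[[brB _] dimStab] dimB]|[e se [w dimcone]]].
  have [e se w] := Sigma_word_exists K_galois K_cyclic s_pos brB dimB.
  by exists e => //; split=> //; have [_ _ <-] := word_spec e se w.
have [brB dimB StabB] := word_spec e se w.
split=> //; split; last by rewrite StabB.
by split=> //; rewrite dimB; case: beta_pos.
Qed.
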